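(* Let $A$ be a Noetherian semi-local ring such that $A_M$ is a one-dimensional Cohen-Macaulay local ring for every maximal ideal $M$ of $A$. Suppose that $\overline{A}$ is a finitely generated $A$-module. Then the Arf closure of $A$ coincides with the strict closure of $A$ in $\overline{A}$.
   Context: For a commutative ring $A$, $Q(A)$ denotes its total ring of fractions and $\overline{A}$ the integral closure of $A$ in $Q(A)$. The strict closure of $A$ in $\overline{A}$ is the subring $A^{*}=\{ x \in \overline{A} \mid x \otimes 1 = 1 \otimes x \text{ in } \overline{A} \otimes_A \overline{A}\}$ of $\overline{A}$. A Noetherian semi-local ring $B$ such that $B_M$ is a one-dimensional Cohen-Macaulay local ring for every maximal ideal $M$ is called an Arf ring if: (1) every integrally closed ideal $I$ of $B$ containing a non-zerodivisor on $B$ has a principal reduction, i.e., $I^{n+1}=aI^n$ for some $n\ge 0$ and $a\in I$; and (2) if $x,y,z\in B$ are such that $x$ is a non-zerodivisor on $B$ and $y/x, z/x\in Q(B)$ are integral over $B$, then $yz/x\in B$. The Arf closure of $A$ is the smallest (with respect to inclusion) Arf ring among all the Arf rings between $A$ and $\overline{A}$ (it exists by work of Lipman). *)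

(* Defs.v *)
From HB Require Import structures.
From mathcomp Require Import all_boot all_order all_algebra.
From mathcomp Require Import generic_quotient ring_quotient.
From mathcomp Require Import freeg ring.
From mathcomp Require Import boolp classical_sets cardinality.

Set Implicit Arguments.
Unset Strict Implicit.
Unset Printing Implicit Defensive.

Import GRing.Theory.

Local Open Scope classical_set_scope.
Local Open Scope quotient_scope.
Local Open Scope ring_scope.

(* Localization S^-1 R at a multiplicative subset S, possibly containing      *)
(* zero-divisors.                                                             *)
Section Localization.

Variables (R : comPzRingType) (S : mulrClosed R).

Definition ratio : Type := {p : R * R | p.2 \in S}.

Implicit Types x y z : ratio.

Definition mk_ratio (a s : R) (Ss : s \in S) : ratio := Sub (a, s) Ss.

Notation num x := (val x).1.
Notation den x := (val x).2.

Definition ratio_eq x y :=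
  `[< exists2 u, u \in S & u * (num x * den y) = u * (num y * den x) >].

Lemma ratio_eq_refl : reflexive ratio_eq.
Proof. by move=> x; apply/asboolP; exists 1; rewrite ?rpred1. Qed.

Lemma ratio_eq_sym : symmetric ratio_eq.
Proof. by move=> x y; apply/asboolP/asboolP => -[u Su e]; exists u. Qed.

Lemma ratio_eq_trans : transitive ratio_eq.
Proof.
move=> y x z /asboolP[u Su e1] /asboolP[v Sv e2]; apply/asboolP.
exists (u * v * den y); first by rewrite !rpredM ?(valP y).
transitivity (u * (num x * den y) * (v * den z)); first by ring.
rewrite e1; transitivity (v * (num y * den z) * (u * den x)); first by ring.
by rewrite e2; ring.
Qed.

Canonical ratio_equiv :=
  EquivRel ratio_eq ratio_eq_refl ratio_eq_sym ratio_eq_trans.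

Definition loc : Type := {eq_quot ratio_eq}.

HB.instance Definition _ : EqQuotient _ ratio_eq loc := EqQuotient.on loc.
HB.instance Definition _ := Choice.on loc.

Definition frac (a s : R) (Ss : s \in S) : loc := \pi_loc (mk_ratio a Ss).

Lemma fracP (c : loc) : exists a s, exists Ss : s \in S, c = frac a Ss.
Proof.
elim/quotW: c => -[[a s] /= Ss]; exists a, s, Ss.
by congr (\pi_loc _); apply: val_inj.
Qed.

Lemma frac_eq (a b s t : R) (Ss : s \in S) (St : t \in S) :
  frac a Ss = frac b St <-> exists2 u, u \in S & u * (a * t) = u * (b * s).
Proof.
split=> [/eqmodP/asboolP //|h].
by apply/eqmodP/asboolP.
Qed.

Lemma ratio_reprP x : exists2 u, u \in S &
  u * (num (repr (\pi_loc x)) * den x) = u * (num x * den (repr (\pi_loc x))).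
Proof.
have /eqmodP/asboolP[u Su e] : repr (\pi_loc x) = x %[mod loc] by rewrite reprK.
by exists u.
Qed.

Definition ratio_add x y : ratio :=
  mk_ratio (num x * den y + num y * den x) (rpredM (valP x) (valP y)).
Definition ratio_mul x y : ratio :=
  mk_ratio (num x * num y) (rpredM (valP x) (valP y)).
Definition ratio_opp x : ratio := mk_ratio (- num x) (valP x).

Definition loc0 : loc := frac 0 (rpred1 S).
Definition loc1 : loc := frac 1 (rpred1 S).
Definition loc_add := lift_op2 loc ratio_add.
Definition loc_mul := lift_op2 loc ratio_mul.
Definition loc_opp := lift_op1 loc ratio_opp.

Lemma loc_addE (a b s t : R) (Ss : s \in S) (St : t \in S) :
  loc_add (frac a Ss) (frac b St) = frac (a * t + b * s) (rpredM Ss St).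
Proof.
unlock loc_add; apply/eqmodP/asboolP => /=.
have [u Su eu] := ratio_reprP (mk_ratio a Ss).
have [v Sv ev] := ratio_reprP (mk_ratio b St).
exists (u * v); first by rewrite rpredM.
rewrite /frac; move: (repr _) (repr _) eu ev => y x /= eu ev.
transitivity (u * (num x * s) * (v * den y * t) +
              v * (num y * t) * (u * den x * s)); first by ring.
by rewrite eu ev; ring.
Qed.

Lemma loc_mulE (a b s t : R) (Ss : s \in S) (St : t \in S) :
  loc_mul (frac a Ss) (frac b St) = frac (a * b) (rpredM Ss St).
Proof.
unlock loc_mul; apply/eqmodP/asboolP => /=.
have [u Su eu] := ratio_reprP (mk_ratio a Ss).
have [v Sv ev] := ratio_reprP (mk_ratio b St).
exists (u * v); first by rewrite rpredM.
rewrite /frac; move: (repr _) (repr _) eu ev => y x /= eu ev.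
transitivity (u * (num x * s) * (v * (num y * t))); first by ring.
by rewrite eu ev; ring.
Qed.

Lemma loc_oppE (a s : R) (Ss : s \in S) : loc_opp (frac a Ss) = frac (- a) Ss.
Proof.
unlock loc_opp; apply/eqmodP/asboolP => /=.
have [u Su eu] := ratio_reprP (mk_ratio a Ss).
exists u => //; rewrite /frac; move: (repr _) eu => x /= eu.
by rewrite !mulNr !mulrN eu.
Qed.

Lemma frac_congr (a b s t : R) (Ss : s \in S) (St : t \in S) :
  a * t = b * s -> frac a Ss = frac b St.
Proof. by move=> e; apply/frac_eq; exists 1; rewrite ?rpred1 // e. Qed.

Lemma loc_addA : associative loc_add.
Proof.
move=> c d e; have [a [s [Ss ->]]] := fracP c.
have [b [t [St ->]]] := fracP d; have [p [r [Sr ->]]] := fracP e.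
by rewrite !loc_addE; apply: frac_congr; ring.
Qed.

Lemma loc_addC : commutative loc_add.
Proof.
move=> c d; have [a [s [Ss ->]]] := fracP c; have [b [t [St ->]]] := fracP d.
by rewrite !loc_addE; apply: frac_congr; ring.
Qed.

Lemma loc_add0 : left_id loc0 loc_add.
Proof.
move=> c; have [a [s [Ss ->]]] := fracP c.
by rewrite !loc_addE; apply: frac_congr; ring.
Qed.

Lemma loc_addN : left_inverse loc0 loc_opp loc_add.
Proof.
move=> c; have [a [s [Ss ->]]] := fracP c.
by rewrite loc_oppE loc_addE; apply: frac_congr; ring.
Qed.

HB.instance Definition _ :=
  GRing.isZmodule.Build loc loc_addA loc_addC loc_add0 loc_addN.

Lemma loc_mulA : associative loc_mul.
Proof.
move=> c d e; have [a [s [Ss ->]]] := fracP c.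
have [b [t [St ->]]] := fracP d; have [p [r [Sr ->]]] := fracP e.
by rewrite !loc_mulE; apply: frac_congr; ring.
Qed.

Lemma loc_mulC : commutative loc_mul.
Proof.
move=> c d; have [a [s [Ss ->]]] := fracP c; have [b [t [St ->]]] := fracP d.
by rewrite !loc_mulE; apply: frac_congr; ring.
Qed.

Lemma loc_mul1 : left_id loc1 loc_mul.
Proof.
move=> c; have [a [s [Ss ->]]] := fracP c.
by rewrite !loc_mulE; apply: frac_congr; ring.
Qed.

Lemma loc_mulDl : left_distributive loc_mul loc_add.
Proof.
move=> c d e; have [a [s [Ss ->]]] := fracP c.
have [b [t [St ->]]] := fracP d; have [p [r [Sr ->]]] := fracP e.
by rewrite loc_addE !loc_mulE loc_addE; apply: frac_congr; ring.
Qed.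

HB.instance Definition _ := GRing.Zmodule_isComPzRing.Build loc
  loc_mulA loc_mulC loc_mul1 loc_mulDl.

Definition to_loc (a : R) : loc := frac a (rpred1 S).

Lemma to_loc_zmod_morphism : zmod_morphism to_loc.
Proof.
move=> a b; transitivity (loc_add (to_loc a) (loc_opp (to_loc b))); last by [].
rewrite /to_loc [loc_opp _]loc_oppE [RHS]loc_addE.
apply: frac_congr; ring.
Qed.

Lemma to_loc_monoid_morphism : monoid_morphism to_loc.
Proof.
split=> // a b; rewrite /to_loc [RHS]loc_mulE.
by apply: frac_congr; ring.
Qed.

HB.instance Definition _ :=
  GRing.isZmodMorphism.Build R loc to_loc to_loc_zmod_morphism.
HB.instance Definition _ :=
  GRing.isMonoidMorphism.Build R loc to_loc to_loc_monoid_morphism.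

End Localization.

Section Ideals.

Variable R : comPzRingType.
Implicit Types I J M P : set R.

Definition is_ideal I :=
  [/\ I 0, forall x y, I x -> I y -> I (x + y) & forall a x, I x -> I (a * x)].

Definition ideal_span (X : set R) : set R := smallest is_ideal X.

Definition ideal_mul I J : set R := ideal_span [set a * b | a in I & b in J].

Definition ideal_exp I (n : nat) : set R := iter n (ideal_mul I) setT.

Definition prime_ideal P :=
  [/\ is_ideal P, ~ P 1 & forall x y, P (x * y) -> P x \/ P y].

Definition maximal_ideal M :=
  [/\ is_ideal M, ~ M 1 & forall J, is_ideal J -> ~ J 1 -> M `<=` J -> J = M].

Lemma maximal_ideal_prime M : maximal_ideal M -> prime_ideal M.
Proof.
case=> -[M0 MD MZ] M1 Mmax; split=> // x y Mxy.
apply: contrapT => /not_orP[nMx nMy].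
pose J : set R := [set z | exists a b, M a /\ z = a + b * x].
have JM z : M z -> J z by move=> Mz; exists z, 0; rewrite mul0r addr0.
have Jx : J x by exists 0, 1; rewrite mul1r add0r.
have idJ : is_ideal J.
  split; first exact: JM.
  - move=> _ _ [a [b [Ma ->]]] [c [d [Mc ->]]].
    by exists (a + c), (b + d); split; [exact: MD | ring].
  - move=> r _ [a [b [Ma ->]]].
    by exists (r * a), (r * b); split; [exact: MZ | ring].
have [J1|nJ1] := pselect (J 1); last by apply: nMx; rewrite -(Mmax J).
have [a [b [Ma e]]] := J1; apply: nMy.
have -> : y = y * a + b * (x * y).
  by transitivity ((a + b * x) * y); [rewrite -e mul1r | ring].
by apply: MD; apply: MZ.
Qed.

Definition noetherian :=
  forall I, is_ideal I -> exists s : seq R, I = ideal_span [set` s].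

Definition semilocal := finite_set [set M | maximal_ideal M].

(* Krull dimension, as the maximal length of a chain of primes p 0 < ... < p n *)
Definition prime_chain (n : nat) (p : nat -> set R) :=
  (forall i, (i <= n)%N -> prime_ideal (p i)) /\
  (forall i, (i < n)%N -> p i `<` p i.+1).

Definition is_krull_dim (d : nat) :=
  (exists p, prime_chain d p) /\
  (forall n p, prime_chain n p -> (n <= d)%N).

Definition regular_seq (s : seq R) :=
  (forall i, (i < size s)%N -> forall x,
     ideal_span [set` take i s] (s`_i * x) -> ideal_span [set` take i s] x) /\
  ~ ideal_span [set` s] 1.

Definition is_depth M (d : nat) :=
  (exists s, [/\ regular_seq s, [set` s] `<=` M & size s = d]) /\
  (forall s, regular_seq s -> [set` s] `<=` M -> (size s <= d)%N).

(* Noetherian local ring with Krull dimension and depth both equal to d *)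
Definition cohen_macaulay_local (d : nat) :=
  noetherian /\
  exists M, [/\ forall N, maximal_ideal N <-> N = M, is_krull_dim d
              & is_depth M d].

Definition integral_over_ideal I (x : R) :=
  exists (n : nat) (a : nat -> R),
    [/\ (0 < n)%N, forall i, (1 <= i <= n)%N -> ideal_exp I i (a i)
      & x ^+ n + \sum_(1 <= i < n.+1) a i * x ^+ (n - i) = 0].

Definition integrally_closed_ideal I :=
  is_ideal I /\ forall x, integral_over_ideal I x -> I x.

Definition has_principal_reduction I :=
  exists (n : nat) (a : R),
    I a /\ ideal_exp I n.+1 = [set a * x | x in ideal_exp I n].

End Ideals.

Section LocalizationAtPrime.

Variables (R : comPzRingType) (P : set R) (primeP : prime_ideal P).

Definition prime_compl of prime_ideal P : {pred R} := [pred x | `[< ~ P x >]].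

Lemma prime_compl_mulr_closed : mulr_closed (prime_compl primeP).
Proof.
have [_ P1 PM] := primeP; split; first exact/asboolP.
by move=> x y /asboolP Px /asboolP Py; apply/asboolP => /PM[].
Qed.

HB.instance Definition _ :=
  GRing.isMulClosed.Build R (prime_compl primeP) prime_compl_mulr_closed.

Definition loc_at : comPzRingType := loc (prime_compl primeP).

End LocalizationAtPrime.

Definition locally_cm_dim1 (R : comPzRingType) :=
  forall (M : set R) (maxM : maximal_ideal M),
    cohen_macaulay_local (loc_at (maximal_ideal_prime maxM)) 1.

Section TotalFractions.

Variable R : comNzRingType.

(* In a commutative ring GRing.lreg x says that x is a non-zerodivisor. *)
Definition nzd : {pred R} := [pred x | `[< GRing.lreg x >]].

Lemma nzd_mulr_closed : mulr_closed nzd.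
Proof.
split; first by apply/asboolP; exact: lreg1.
by move=> x y /asboolP lx /asboolP ly; apply/asboolP; exact: lregM.
Qed.

HB.instance Definition _ := GRing.isMulClosed.Build R nzd nzd_mulr_closed.

Definition total_frac : Type := loc nzd.

HB.instance Definition _ := GRing.ComPzRing.on total_frac.

Lemma total_frac_oner_neq0 : (1 : total_frac) != 0.
Proof.
apply/eqP => /frac_eq[u /asboolP lu] /lu /eqP.
by rewrite !mulr1 oner_eq0.
Qed.

HB.instance Definition _ :=
  GRing.PzSemiRing_isNonZero.Build total_frac total_frac_oner_neq0.

Definition to_frac (a : R) : total_frac := to_loc nzd a.

HB.instance Definition _ := GRing.RMorphism.copy to_frac (to_loc nzd).

End TotalFractions.

Arguments nzd R : clear implicits.
Arguments to_frac {R} a.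

Section SubringType.

Variables (R : comNzRingType) (S : subringClosed R).

Record subring_type :=
  SubringElt { subring_val :> R; _ : subring_val \in S }.

HB.instance Definition _ := [isSub for subring_val].
HB.instance Definition _ := [Choice of subring_type by <:].
HB.instance Definition _ := [SubChoice_isSubComNzRing of subring_type by <:].

End SubringType.

Section IntegralClosure.

Variable A : comNzRingType.

Definition integral_pred : {pred total_frac A} :=
  [pred x | `[< integralOver to_frac x >]].

Lemma integral_pred_subring : subring_closed integral_pred.
Proof.
split=> [|x y /asboolP ix /asboolP iy|x y /asboolP ix /asboolP iy];
  apply/asboolP.
- exact: (@integral1 A (total_frac A) to_frac).
- exact: (@integral_sub A (total_frac A) to_frac x y ix iy).
- exact: (@integral_mul A (total_frac A) to_frac x y ix iy).
Qed.

HB.instance Definition _ :=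
  GRing.isSubringClosed.Build (total_frac A) integral_pred
    integral_pred_subring.

Definition integral_closure : Type := subring_type integral_pred.

HB.instance Definition _ := GRing.ComNzRing.on integral_closure.

Lemma to_frac_integral (a : A) : to_frac a \in integral_pred.
Proof. by apply/asboolP; exact: (@integral_id A (total_frac A) to_frac). Qed.

Definition to_closure (a : A) : integral_closure :=
  SubringElt (to_frac_integral a).

Lemma to_closure_zmod_morphism : zmod_morphism to_closure.
Proof. by move=> a b; apply: val_inj; rewrite /= rmorphB. Qed.

Lemma to_closure_monoid_morphism : monoid_morphism to_closure.
Proof.
by split=> [|a b]; apply: val_inj; rewrite /= ?rmorph1 ?rmorphM.
Qed.

HB.instance Definition _ := GRing.isZmodMorphism.Build A integral_closure
  to_closure to_closure_zmod_morphism.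
HB.instance Definition _ := GRing.isMonoidMorphism.Build A integral_closure
  to_closure to_closure_monoid_morphism.

Definition closure_scale (a : A) (x : integral_closure) : integral_closure :=
  to_closure a * x.

Lemma closure_scaleA a b x :
  closure_scale a (closure_scale b x) = closure_scale (a * b) x.
Proof. by rewrite /closure_scale rmorphM mulrA. Qed.

Lemma closure_scale1 : left_id 1 closure_scale.
Proof. by move=> x; rewrite /closure_scale rmorph1 mul1r. Qed.

Lemma closure_scaleDr : right_distributive closure_scale +%R.
Proof. by move=> a x y; rewrite /closure_scale mulrDr. Qed.

Lemma closure_scaleDl x : {morph closure_scale^~ x : a b / a + b}.
Proof. by move=> a b; rewrite /closure_scale rmorphD mulrDl. Qed.

HB.instance Definition _ := GRing.Zmodule_isLmodule.Build A integral_closure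
  closure_scaleA closure_scale1 closure_scaleDr closure_scaleDl.

End IntegralClosure.

Definition finitely_generated (R : pzRingType) (V : lmodType R) :=
  exists (n : nat) (e : 'I_n -> V),
    forall x, exists c : 'I_n -> R, x = \sum_(i < n) c i *: e i.

(* The tensor product over R: the free abelian group on V * W modulo the      *)
(* subgroup generated by the bilinearity relations. Only its additive group   *)
(* structure is provided.                                                     *)
Section Tensor.

Variables (R : comNzRingType) (V W : lmodType R).

Definition is_subgroup (Z : zmodType) (H : set Z) :=
  H 0 /\ forall x y, H x -> H y -> H (x - y).

Definition tensor_relator (g : {freeg (V * W)}) :=
  [\/ exists v v' w, g = << (v + v', w) >> - << (v, w) >> - << (v', w) >>,
      exists v w w', g = << (v, w + w') >> - << (v, w) >> - << (v, w') >>
    | exists a v w, g = << (a *: v, w) >> - << (v, a *: w) >>].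

Definition tensor_relations : {pred {freeg (V * W)}} :=
  [pred g | `[< smallest (@is_subgroup _) tensor_relator g >]].

Lemma tensor_relations_zmod_closed : zmod_closed tensor_relations.
Proof.
split=> [|x y /asboolP hx /asboolP hy]; apply/asboolP.
  by move=> H [[H0 _] _].
by move=> H HP; have [[_ HB] _] := HP; apply: HB; [exact: hx | exact: hy].
Qed.

HB.instance Definition _ := GRing.isZmodClosed.Build {freeg (V * W)}
  tensor_relations tensor_relations_zmod_closed.

Definition tensor : zmodType := Quotient.quot tensor_relations.

Definition tmul (v : V) (w : W) : tensor := \pi_tensor << (v, w) >>.

Lemma tensor_eqP (g h : {freeg (V * W)}) :
  reflect (\pi_tensor g = \pi_tensor h) (g - h \in tensor_relations).
Proof. by rewrite Quotient.idealrBE; exact: eqP. Qed.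

Lemma pi_tensorB (g h : {freeg (V * W)}) :
  \pi_tensor (g - h) = \pi_tensor g - \pi_tensor h.
Proof. exact: (raddfB (\pi_tensor)). Qed.

Lemma tensor_relator_eq0 (g : {freeg (V * W)}) :
  tensor_relator g -> \pi_tensor g = 0.
Proof.
move=> rg; transitivity (\pi_tensor 0); last exact: (raddf0 (\pi_tensor)).
apply/tensor_eqP; rewrite subr0; apply/asboolP.
exact: sub_gen_smallest.
Qed.

Lemma tmulDl v v' w : tmul (v + v') w = tmul v w + tmul v' w.
Proof.
apply/eqP; rewrite -subr_eq0 opprD addrA -!pi_tensorB; apply/eqP.
by apply: tensor_relator_eq0; apply: Or31; exists v, v', w.
Qed.

Lemma tmulDr v w w' : tmul v (w + w') = tmul v w + tmul v w'.
Proof.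
apply/eqP; rewrite -subr_eq0 opprD addrA -!pi_tensorB; apply/eqP.
by apply: tensor_relator_eq0; apply: Or32; exists v, w, w'.
Qed.

Lemma tmulZ a v w : tmul (a *: v) w = tmul v (a *: w).
Proof.
apply/eqP; rewrite -subr_eq0 -!pi_tensorB; apply/eqP.
by apply: tensor_relator_eq0; apply: Or33; exists a, v, w.
Qed.

Lemma tensor_lift (T : zmodType) (f : V -> W -> T) :
  (forall v v' w, f (v + v') w = f v w + f v' w) ->
  (forall v w w', f v (w + w') = f v w + f v w') ->
  (forall a v w, f (a *: v) w = f v (a *: w)) ->
  exists F : {additive tensor -> T}, forall v w, F (tmul v w) = f v w.
Proof.
move=> fDl fDr fZ.
pose f' (p : V * W) : zmodule T := f p.1 p.2.
pose L (g : {freeg (V * W)}) : T := fglift f' g.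
have LB g h : L (g - h) = L g - L h by exact: (lift_is_additive f' g h).
have LU v w : L << (v, w) >> = f v w by rewrite /L liftU scale1r.
have L0 g : g \in tensor_relations -> L g = 0.
  move=> /asboolP/(_ [set h | L h = 0]); apply; split.
    split=> [|x y Lx Ly] /=; first by rewrite -(subrr 0) LB subrr.
    by rewrite LB Lx Ly subr0.
  move=> h [[v [v' [w ->]]]|[v [w [w' ->]]]|[a [v [w ->]]]] /=.
  - by rewrite !LB !LU fDl addrAC addrK subrr.
  - by rewrite !LB !LU fDr addrAC addrK subrr.
  - by rewrite LB !LU fZ subrr.
have Lpi g h : \pi_tensor g = \pi_tensor h -> L g = L h.
  move=> /tensor_eqP/L0/eqP; rewrite LB subr_eq0 => /eqP; exact.
pose F (q : tensor) : T := L (repr q).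
have FB : zmod_morphism F.
  move=> q r; rewrite /F -LB; apply: Lpi.
  by rewrite pi_tensorB !reprK.
pose F' : {additive tensor -> T} :=
  HB.pack F (GRing.isZmodMorphism.Build tensor T F FB).
exists F' => v w; rewrite -LU; apply: Lpi.
by rewrite reprK.
Qed.

End Tensor.

Section StrictClosure.

Variable A : comNzRingType.
Local Notation B := (integral_closure A).
Local Notation "x \ox y" := (@tmul A B B x y) (at level 40).
Implicit Types x y u v : B.

Definition strict_closure_pred : {pred B} := [pred x : B | x \ox 1 == 1 \ox x].

Lemma closure_scaleAl (a : A) x y : (a *: x) * y = a *: (x * y).
Proof. by rewrite -[LHS]mulrA. Qed.

Lemma strict_closure_subring : subring_closed strict_closure_pred.
Proof.
split=> [|x y|x y]; first by rewrite inE.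
- rewrite !inE => /eqP ex /eqP ey; apply/eqP.
  have tBl u v : (u - v) \ox 1 = u \ox 1 - v \ox 1.
    by apply: (addIr (v \ox 1)); rewrite -tmulDl !subrK.
  have tBr u v : 1 \ox (u - v) = 1 \ox u - 1 \ox v.
    by apply: (addIr (1 \ox v)); rewrite -tmulDr !subrK.
  by rewrite tBl tBr ex ey.
- rewrite !inE => /eqP ex /eqP ey; apply/eqP.
  have [|||F FE] := @tensor_lift A B B _ (fun u v => (u * y) \ox v).
  - by move=> u u' v /=; rewrite mulrDl tmulDl.
  - by move=> u v v' /=; rewrite tmulDr.
  - by move=> a u v /=; rewrite closure_scaleAl tmulZ.
  have [|||G GE] := @tensor_lift A B B _ (fun u v => u \ox (v * x)).
  - by move=> u u' v /=; rewrite tmulDl.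
  - by move=> u v v' /=; rewrite mulrDl tmulDr.
  - by move=> a u v /=; rewrite closure_scaleAl tmulZ.
  have := congr1 F ex; rewrite !FE mul1r => ->.
  by have := congr1 G ey; rewrite !GE mul1r mulrC => ->; rewrite mulrC.
Qed.

HB.instance Definition _ :=
  GRing.isSubringClosed.Build (integral_closure A) strict_closure_pred
    strict_closure_subring.

Definition strict_closure : subringClosed (integral_closure A) :=
  strict_closure_pred.

End StrictClosure.

Section Arf.

(* y/x and z/x are formed in the total ring of fractions of B *)
Definition is_arf (B : comNzRingType) :=
  [/\ noetherian B, semilocal B, locally_cm_dim1 B,
      forall I : set B, integrally_closed_ideal I ->
        (exists x, I x /\ x \in nzd B) -> has_principal_reduction I
    & forall (x y z : B) (xnzd : x \in nzd B),
        integralOver to_frac (frac y xnzd : total_frac B) ->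
        integralOver to_frac (frac z xnzd : total_frac B) ->
        exists b : B, frac (y * z) xnzd = to_frac b].

Variable A : comNzRingType.

(* Rings between A and its integral closure are the subrings of the latter *)
(* containing the image of A.                                              *)
Definition arf_between (C : subringClosed (integral_closure A)) :=
  (forall a : A, to_closure a \in C) /\ is_arf (subring_type C).

Definition is_arf_closure (C : subringClosed (integral_closure A)) :=
  arf_between C /\
  forall D : subringClosed (integral_closure A),
    arf_between D -> {subset C <= D}.

Lemma is_arf_closure_uniq (C D : subringClosed (integral_closure A)) :
  is_arf_closure C -> is_arf_closure D -> C =i D.
Proof.
by move=> [arfC minC] [arfD minD] x; apply/idP/idP; [exact: minC | exact: minD].
Qed.

End Arf.

(* Main.v *)
Require Import Defs.
From HB Require Import structures.
From mathcomp Require Import all_boot all_order all_algebra.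
From mathcomp Require Import generic_quotient ring_quotient ring.
From mathcomp Require Import boolp classical_sets cardinality.
Require Import Defs.

(** Write [B] for the integral closure of [A] and [C] for the strict closure. As
    [B] is a finite [A]-module, [B] and [C] inherit from [A] the Noetherian,
    semilocal and Cohen-Macaulay conditions. For a Noetherian ring,
    [locally_cm_dim1] amounts to two conditions that go up along integral
    extensions: there is no chain of three primes, and every maximal ideal
    contains a regular element ([locally_cm_dim1_of], [cm_dim1_no_three_primes],
    [cm_dim1_maximals_regular]).

    [C] is an Arf ring ([strict_closure_arf]). Its elements move across the
    tensor sign, so [y = x u] and [z = x v] with [x], [y], [z] in [C] give
    [x u v] in [C]. For the principal reductions, every maximal ideal of [B] is
    principal, so two elements [x], [y] of [C] with [x] regular are [g x'] and
    [g y'] with [x'] and [y'] comaximal. There is a splitting [e + f = 1] in [B],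
    idempotent modulo the conductor, for which [x e + y f] generates [g B]
    ([split_powers]); and [x e + y f] is in [C], because the cross terms
    [x e (x) f] and [y e (x) f] depend only on the products [x e f] and [y e f]
    ([balanced_combination], [strict_closure_gcd]). Hence an integrally closed
    ideal [I] of [C] with a regular element has an element [w] with [I B = w B],
    and then [I ^ 2 = w I].

    [C] lies in every Arf ring [D] between [A] and [B]
    ([strict_closure_sub_arf]). More generally, let [E] be a blow-up
    [{u | b u \in D}] of [D], where [b] is a regular element of [D]; an element
    [x] with [x (x) 1 = 1 (x) x] over [E] is in [E] ([blowup_strictly_closed]).
    Otherwise let [N] be a maximal ideal of [E] that contains the [d] with
    [d x] in [E]. Since [D] is Arf, there is [a] in [N] with [N B = a B], and
    [E' = {u | a u \in E}] is a larger blow-up. Reducing modulo [a B] shows that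
    [x] is in [E + a B] ([strictly_closed_residue]), so one may suppose
    [x = a y]. The main point is that multiplication by [a] is an injective map
    from the tensor square of [B] over [E'] to the one over [E]
    ([strictly_closed_divide]). Indeed, the kernel of
    [a B (x) B -> B (x) B] over [E] comes from relations [sum_i c_i v_i = 0]
    with [c_i] in [E'], as tensors [sum_i a c_i e (x) v_i], and these vanish
    over [E'] because they equal [a e (x) sum_i c_i v_i]. So [y] satisfies the
    hypothesis over [E'], and Noetherian induction applies. *)

Set Implicit Arguments.
Unset Strict Implicit.
Unset Printing Implicit Defensive.

Import GRing.Theory.

Local Open Scope classical_set_scope.
Local Open Scope quotient_scope.
Local Open Scope ring_scope.

(** * Ideals of Noetherian rings *)

Lemma chain_mono (T : Type) (F : nat -> set T) : (forall n, F n `<=` F n.+1) ->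
  forall m n, (m <= n)%N -> F m `<=` F n.
Proof.
move=> FS m n /subnK <-; elim: (n - m)%N => // k IH x Fx; rewrite addSn.
by apply: FS; exact: IH.
Qed.

(** The closure system is left abstract in order to cover both the ideals of a
    ring and the submodules of a module. *)
Section MaximalMembers.

Variables (V : eqType) (closed : set V -> Prop).
Hypothesis fin_gen : forall N, closed N -> exists s : seq V, N = smallest closed [set` s].
Hypothesis chain_closed : forall F : nat -> set V, (forall n, closed (F n)) ->
  (forall n, F n `<=` F n.+1) -> closed (\bigcup_n F n).

Lemma maximal_member (G : set V -> Prop) :
  (forall N, G N -> closed N) -> (exists N, G N) ->
  exists N, G N /\ forall N', G N' -> N `<=` N' -> N' = N.
Proof.
move=> Gc [N0 GN0]; apply: contrapT => nomax.
have step N : exists N', G N -> [/\ G N', N `<=` N' & N' <> N].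
  have [GN|nGN] := pselect (G N); last by exists N.
  apply: contrapT => noN'; apply: nomax; exists N; split=> // N' GN' NN'.
  by apply: contrapT => ne; apply: noN'; exists N'.
have [f fP] := choice step.
pose F n := iter n f N0.
have GF n : G (F n) by elim: n => //= n /fP[].
have FS n : F n `<=` F n.+1 by have [] := fP _ (GF n).
have Fmono m n := @chain_mono _ F FS m n.
have [s Us] := fin_gen (chain_closed (fun n => Gc _ (GF n)) FS).
have [n sn] : exists n, [set` s] `<=` F n.
  have : [set` s] `<=` \bigcup_n F n by rewrite Us; exact: sub_gen_smallest.
  elim: s {Us} => [_|x s IH sU]; first by exists 0%N => x.
  have [m _ Fx] := sU x (mem_head _ _).
  have [|n sn] := IH; first by move=> y /= ys; apply: sU; rewrite /= inE ys orbT.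
  exists (maxn m n) => y /=; rewrite inE => /predU1P[->|/sn].
    exact: (Fmono m) (leq_maxl _ _) _ Fx.
  exact: (Fmono n) (leq_maxr _ _) _.
have [_ _] := fP _ (GF n); apply; apply/seteqP; split; last exact: FS.
apply: (@subset_trans _ (\bigcup_n F n)); first by move=> x Fx; exists n.+1.
by rewrite Us; apply: smallest_sub => //; exact: Gc.
Qed.

Lemma noetherian_induction (P : set V -> Prop) :
  (forall N, closed N ->
     (forall N', closed N' -> N `<=` N' -> N' <> N -> P N') -> P N) ->
  forall N, closed N -> P N.
Proof.
move=> Pstep N cN; apply: contrapT => nPN.
have [|M [[cM nPM] maxM]] :=
  @maximal_member (fun M => closed M /\ ~ P M) (fun M => @proj1 _ _).
  by exists N.
apply: nPM; apply: Pstep => // M' cM' MM' ne; apply: contrapT => nPM'.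
by apply: ne; apply: maxM.
Qed.

End MaximalMembers.

Section IdealTheory.

Variable R : comPzRingType.
Implicit Types I J P M : set R.

Lemma ideal_chain (F : nat -> set R) : (forall n, is_ideal (F n)) ->
  (forall n, F n `<=` F n.+1) -> is_ideal (\bigcup_n F n).
Proof.
move=> idF FS.
have Fmono m n := @chain_mono _ F FS m n.
split; first by exists 0%N => //; have [] := idF 0%N.
  move=> x y [m _ Fx] [n _ Fy]; exists (maxn m n) => //.
  have [_ + _] := idF (maxn m n); apply.
    exact: (Fmono m) (leq_maxl _ _) _ Fx.
  exact: (Fmono n) (leq_maxr _ _) _ Fy.
by move=> a x [n _ Fx]; exists n => //; have [_ _] := idF n; apply.
Qed.

Lemma ideal_span_ideal (X : set R) : is_ideal (ideal_span X).
Proof.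
split=> [J [[J0 _ _] _] //|x y Sx Sy J JX|a x Sx J JX].
  by have [[_ JD _] _] := JX; apply: JD; [exact: Sx | exact: Sy].
by have [[_ _ JZ] _] := JX; apply: JZ; exact: Sx.
Qed.

Lemma setT_ideal : is_ideal (setT : set R). Proof. by split. Qed.

Lemma zero_ideal : is_ideal [set 0 : R].
Proof. by split=> [//|x y /= -> ->|a x /= ->]; rewrite ?addr0 ?mulr0. Qed.

Lemma idealN I x : is_ideal I -> I x -> I (- x).
Proof. by case=> _ _ IZ Ix; rewrite -mulN1r; exact: IZ. Qed.

Lemma idealB I x y : is_ideal I -> I x -> I y -> I (x - y).
Proof. by move=> idI Ix Iy; have [_ ID _] := idI; apply: ID => //; exact: idealN. Qed.

Lemma ideal_sum (T : Type) (r : seq T) (Q : pred T) (F : T -> R) I : is_ideal I ->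
  (forall i, Q i -> I (F i)) -> I (\sum_(i <- r | Q i) F i).
Proof. by move=> [I0 ID _] IF; elim/big_ind: _. Qed.

Definition ideal_adjoin I (a : R) : set R := [set z | exists x b, I x /\ z = x + b * a].

Lemma ideal_adjoin_ideal I a : is_ideal I -> is_ideal (ideal_adjoin I a).
Proof.
case=> I0 ID IZ; split.
- by exists 0, 0; rewrite mul0r addr0.
- move=> _ _ [x [b [Ix ->]]] [y [c [Iy ->]]].
  by exists (x + y), (b + c); split; [exact: ID | ring].
- move=> r _ [x [b [Ix ->]]].
  by exists (r * x), (r * b); split; [exact: IZ | ring].
Qed.

Lemma sub_ideal_adjoin I a : I `<=` ideal_adjoin I a.
Proof. by move=> x Ix; exists x, 0; rewrite mul0r addr0. Qed.

Lemma mem_ideal_adjoin I a : is_ideal I -> ideal_adjoin I a a.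
Proof. by case=> I0 _ _; exists 0, 1; rewrite mul1r add0r. Qed.

Lemma ideal_adjoin_sub I a J : is_ideal J -> I `<=` J -> J a -> ideal_adjoin I a `<=` J.
Proof. by move=> [_ JD JZ] IJ Ja _ [x [b [Ix ->]]]; apply: JD; [exact: IJ | exact: JZ]. Qed.

Definition principal (a : R) : set R := [set a * x | x in setT].

Lemma principal_ideal a : is_ideal (principal a).
Proof.
split.
- by exists 0; rewrite ?mulr0.
- by move=> _ _ [x _ <-] [y _ <-]; exists (x + y); rewrite ?mulrDr.
- by move=> b _ [x _ <-]; exists (b * x) => //; ring.
Qed.

Lemma mem_principal a : principal a a.
Proof. by exists 1; rewrite ?mulr1. Qed.

Lemma principal_sub a I : is_ideal I -> I a -> principal a `<=` I.
Proof. by move=> [_ _ IZ] Ia _ [x _ <-]; rewrite mulrC; exact: IZ. Qed.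

Definition mult_set (S : set R) := S 1 /\ forall x y, S x -> S y -> S (x * y).

Lemma prime_compl_mult_set P : prime_ideal P -> mult_set (~` P).
Proof. by case=> _ P1 PM; split=> // x y Px Py /PM[]. Qed.

Lemma powers_mult_set (a : R) : mult_set [set a ^+ n | n in setT].
Proof.
split; first by exists 0%N.
by move=> _ _ [m _ <-] [n _ <-]; exists (m + n)%N; rewrite ?exprD.
Qed.

Lemma mult_setM (S T : set R) : mult_set S -> mult_set T ->
  mult_set [set s * t | s in S & t in T].
Proof.
move=> [S1 SM] [T1 TM]; split; first by exists 1 => //; exists 1 => //; rewrite mulr1.
move=> _ _ [s Ss [t Tt <-]] [s' Ss' [t' Tt' <-]].
exists (s * s'); first exact: SM.
by exists (t * t'); [exact: TM | ring].
Qed.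

Section Noetherian.

Hypothesis noethR : noetherian R.

Lemma maximal_ideal_in (G : set R -> Prop) :
  (forall I, G I -> is_ideal I) -> (exists I, G I) ->
  exists I, G I /\ forall J, G J -> I `<=` J -> J = I.
Proof. by apply: maximal_member; [exact: noethR | exact: ideal_chain]. Qed.

Lemma ideal_induction (Q : set R -> Prop) :
  (forall I, is_ideal I ->
     (forall J, is_ideal J -> I `<=` J -> J <> I -> Q J) -> Q I) ->
  forall I, is_ideal I -> Q I.
Proof. by apply: noetherian_induction; [exact: noethR | exact: ideal_chain]. Qed.

(** An ideal that is maximal among those containing [I] and avoiding [S] is prime. *)
Lemma prime_avoiding I (S : set R) : is_ideal I -> mult_set S ->
  (forall x, I x -> ~ S x) ->
  exists P, [/\ prime_ideal P, I `<=` P & forall x, P x -> ~ S x].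
Proof.
move=> idI [S1 SM] IS.
pose G J := [/\ is_ideal J, I `<=` J & forall x, J x -> ~ S x].
have [||P [[idP IP PS] maxP]] := @maximal_ideal_in G; first by move=> J [].
  by exists I; split.
exists P; split=> //; split=> // [P1|x y Pxy]; first exact: PS S1.
apply: contrapT => /not_orP[nPx nPy].
have meets z : ~ P z -> exists2 s, S s & ideal_adjoin P z s.
  move=> nPz; apply: contrapT => none.
  apply: nPz; rewrite -(maxP (ideal_adjoin P z)); first exact: mem_ideal_adjoin.
    split; first exact: ideal_adjoin_ideal.
      by apply: subset_trans IP _; exact: sub_ideal_adjoin.
    by move=> s Ps Ss; apply: none; exists s.
  exact: sub_ideal_adjoin.
have [s Ss [p [b [Pp es]]]] := meets _ nPx.
have [t St [q [c [Pq et]]]] := meets _ nPy.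
apply: (PS (s * t)); last exact: SM.
have [_ PD PZ] := idP.
have -> : s * t = (q + c * y) * p + b * x * q + b * c * (x * y).
  by rewrite es et; ring.
by apply: (PD); [apply: (PD)|]; exact: (PZ).
Qed.

Lemma maximal_above I : is_ideal I -> ~ I 1 -> exists2 M, maximal_ideal M & I `<=` M.
Proof.
move=> idI nI1.
pose G J := [/\ is_ideal J, I `<=` J & ~ J 1].
have [||M [[idM IM nM1] maxM]] := @maximal_ideal_in G; first by move=> J [].
  by exists I; split.
exists M => //; split=> // J idJ nJ1 MJ; apply: maxM => //; split=> //.
exact: subset_trans MJ.
Qed.

(** This replaces the finiteness of the set of minimal primes over [I]. By
    Noetherian induction: if [I] contains [x y] but neither factor, a prime
    above [I] is above [I + (x)] or above [I + (y)]. *)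
Lemma finite_primes_below I : is_ideal I ->
  exists F : set (set R), [/\ finite_set F,
    forall P, F P -> prime_ideal P /\ I `<=` P
  & forall P, prime_ideal P -> I `<=` P -> exists2 Q, F Q & Q `<=` P].
Proof.
move: I; apply: ideal_induction => J idJ IH.
have [J1|nJ1] := pselect (J 1).
  by exists set0; split=> // P [_ P1 _] JP; case: P1; exact: JP.
have [pJ|npJ] := pselect (prime_ideal J).
  exists [set J]; split=> [|P ->|P _ JP]; [exact: finite_set1 | by split |].
  by exists J.
have [x [y [Jxy nJx nJy]]] : exists x y, [/\ J (x * y), ~ J x & ~ J y].
  apply: contrapT => h; apply: npJ; split=> // x y Jxy.
  by apply: contrapT => /not_orP[nJx nJy]; apply: h; exists x, y.
have bigger z : ~ J z -> ideal_adjoin J z <> J.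
  by move=> nJz e; apply: nJz; rewrite -e; exact: mem_ideal_adjoin.
have [F [finF FP Fmin]] := IH _ (ideal_adjoin_ideal x idJ)
  (@sub_ideal_adjoin J x) (bigger _ nJx).
have [G [finG GP Gmin]] := IH _ (ideal_adjoin_ideal y idJ)
  (@sub_ideal_adjoin J y) (bigger _ nJy).
exists (F `|` G); split; first by rewrite finite_setU.
  move=> P [/FP|/GP] [pP sP]; split=> //; apply: subset_trans sP.
    exact: sub_ideal_adjoin.
  exact: sub_ideal_adjoin.
move=> P pP JP; have [idP _ PM] := pP.
have [Px|Py] := PM _ _ (JP _ Jxy).
  have [Q FQ QP] := Fmin P pP (ideal_adjoin_sub idP JP Px).
  by exists Q => //; left.
have [Q GQ QP] := Gmin P pP (ideal_adjoin_sub idP JP Py).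
by exists Q => //; right.
Qed.

End Noetherian.

Lemma maximal_unitP M x : maximal_ideal M -> ~ M x -> exists y, M (1 - y * x).
Proof.
move=> [idM nM1 maxM] nMx; apply: contrapT => none; apply: nMx.
rewrite -(maxM (ideal_adjoin M x)); first exact: mem_ideal_adjoin.
- exact: ideal_adjoin_ideal.
- move=> [p [b [Mp e]]]; apply: none; exists b.
  by rewrite e addrK.
- exact: sub_ideal_adjoin.
Qed.

Lemma maximal_sub_eq M P : maximal_ideal M -> is_ideal P -> ~ P 1 -> M `<=` P -> P = M.
Proof. by move=> [_ _ maxM] idP nP1; exact: maxM. Qed.

Lemma prime_exp P x n : prime_ideal P -> P (x ^+ n) -> P x.
Proof.
move=> [_ P1 PM]; elim: n => [|n IH]; first by rewrite expr0.
by rewrite exprS => /PM[].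
Qed.

(** This form of dimension at most one passes without effort to localizations
    and to integral extensions. *)
Definition no_three_primes := forall P0 P1 P2 : set R,
  prime_ideal P0 -> prime_ideal P1 -> prime_ideal P2 -> P0 `<` P1 -> P1 `<` P2 -> False.

(** The products of a power of [a] and an element outside [P] form a
    multiplicative set that does not contain [0] since [a] is regular. A prime
    that avoids it lies in [P] and misses [a]; if [P] were strictly inside [M],
    there would be a chain of three primes. *)
Lemma regular_prime_maximal (a : R) P M : noetherian R -> no_three_primes ->
  GRing.lreg a -> prime_ideal P -> P a -> prime_ideal M -> P `<=` M -> P = M.
Proof.
move=> noethR n3 areg pP Pa pM PM; apply: contrapT => ne.
pose S : set R := [set s * t | s in [set a ^+ n | n in setT] & t in ~` P].
have mS : mult_set S.
  by apply: mult_setM; [exact: powers_mult_set | exact: prime_compl_mult_set].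
have [|Q [pQ _ QS]] := prime_avoiding noethR zero_ideal mS.
  move=> _ /= -> [_ [n _ <-]] [t nPt].
  rewrite -(mulr0 (a ^+ n)) => /(lregX areg) t0; apply: nPt.
  by rewrite t0; have [[]] := pP.
apply: (n3 Q P M) => //.
- split; first by move=> x Qx; apply: contrapT => nPx; apply: (QS _ Qx); exists 1;
    [exists 0%N | exists x => //; rewrite mul1r].
  move=> /(_ _ Pa) /QS; apply; exists a; first by exists 1%N.
  by exists 1; [have [] := pP | rewrite mulr1].
- by split=> // MP; apply: ne; apply/seteqP.
Qed.

End IdealTheory.

(** * Localization and Cohen-Macaulay rings of dimension one *)

Section Fractions.

Variables (R : comPzRingType) (S : mulrClosed R).

Lemma fracE a s (Ss : s \in S) : frac a Ss = frac 1 Ss * to_loc S a.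
Proof. by rewrite [RHS]loc_mulE; apply: frac_congr; ring. Qed.

Lemma to_loc_frac a s (Ss : s \in S) : to_loc S a = to_loc S s * frac a Ss.
Proof. by rewrite [RHS]loc_mulE; apply: frac_congr; ring. Qed.

Lemma to_loc_unit s (Ss : s \in S) : to_loc S s * frac 1 Ss = 1.
Proof. by rewrite -to_loc_frac rmorph1. Qed.

End Fractions.

Section LocalizationAtAPrime.

Variables (R : comPzRingType) (P : set R) (pP : prime_ideal P).
Local Notation L := (loc_at pP).
Local Notation S := (prime_compl pP).
Local Notation to_L := (to_loc S).
Implicit Types (I J : set R) (K : set L).

Lemma mem_prime_compl s : s \in S <-> ~ P s.
Proof. by split=> /asboolP. Qed.

Lemma ideal_frac K a s (Ss : s \in S) : is_ideal K -> K (frac a Ss) <-> K (to_L a).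
Proof.
case=> _ _ KZ; split=> Ka; first by rewrite (to_loc_frac _ Ss); exact: KZ.
by rewrite fracE; exact: KZ.
Qed.

(** An ideal of the localization is determined by its contraction; this is how
    finiteness and strict inclusions are transported. *)
Definition contraction K : set R := [set a | K (to_L a)].

Lemma contraction_ideal K : is_ideal K -> is_ideal (contraction K).
Proof.
case=> K0 KD KZ; split; rewrite /contraction /=.
- by rewrite rmorph0.
- by move=> x y Kx Ky; rewrite rmorphD; exact: KD.
- by move=> a x Kx; rewrite rmorphM; exact: KZ.
Qed.

Lemma contraction_prime K : prime_ideal K -> prime_ideal (contraction K).
Proof.
case=> idK K1 KM; split; first exact: contraction_ideal.
- by rewrite /contraction /= rmorph1.
- by move=> x y; rewrite /contraction /= rmorphM => /KM.
Qed.

Lemma contraction_below K : is_ideal K -> ~ K 1 -> contraction K `<=` P.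
Proof.
move=> [_ _ KZ] nK1 a Ka; apply: contrapT => /mem_prime_compl Sa; apply: nK1.
by rewrite -(to_loc_unit Sa) mulrC; exact: KZ.
Qed.

Lemma contraction_sub K K' : is_ideal K -> is_ideal K' ->
  contraction K `<=` contraction K' -> K `<=` K'.
Proof.
move=> idK idK' sKK' z; have [a [s [Ss ->]]] := fracP z.
by move=> /ideal_frac-/(_ idK) /sKK' Ka; apply/ideal_frac.
Qed.

Lemma contraction_proper K K' : is_ideal K -> is_ideal K' -> K `<` K' ->
  contraction K `<` contraction K'.
Proof.
move=> idK idK' [KK' nK'K]; split; first by move=> a; exact: KK'.
by move=> /(contraction_sub idK' idK).
Qed.

Definition extension I : set L := [set z | exists a s (Ss : s \in S), I a /\ z = frac a Ss].

Lemma extension_to_loc I a : I a -> extension I (to_L a).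
Proof. by move=> Ia; exists a, 1, (rpred1 S). Qed.

Lemma extension_ideal I : is_ideal I -> is_ideal (extension I).
Proof.
case=> I0 ID IZ; split.
- by rewrite -(rmorph0 to_L); exact: extension_to_loc.
- move=> _ _ [a [s [Ss [Ia ->]]]] [b [t [St [Ib ->]]]].
  exists (a * t + b * s), (s * t), (rpredM Ss St); split; last exact: loc_addE.
  by apply: ID; rewrite mulrC; exact: IZ.
- move=> z _ [a [s [Ss [Ia ->]]]]; have [b [t [St ->]]] := fracP z.
  by exists (b * a), (t * s), (rpredM St Ss); split; [exact: IZ | exact: loc_mulE].
Qed.

Lemma contraction_extension I : prime_ideal I -> I `<=` P ->
  contraction (extension I) = I.
Proof.
move=> [idI I1 IM] IP; apply/seteqP; split; last by move=> a; exact: extension_to_loc.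
move=> a [b [s [Ss [Ib /frac_eq[u /mem_prime_compl Pu]]]]].
rewrite mulr1 => e; have [_ _ IZ] := idI.
have /IM[/IP //|] : I (u * (a * s)) by rewrite e; exact: IZ.
by case/IM => // /IP /(mem_prime_compl s).1.
Qed.

Lemma extension_prime I : prime_ideal I -> I `<=` P -> prime_ideal (extension I).
Proof.
move=> pI IP; have [idI I1 IM] := pI; have idE := extension_ideal idI.
have cE := contraction_extension pI IP.
split=> // [E1|y z].
  by apply: I1; rewrite -cE /contraction /= rmorph1.
have [a [s [Ss ->]]] := fracP y; have [b [t [St ->]]] := fracP z.
rewrite [X in extension _ X](loc_mulE _ _ Ss St).
move=> /ideal_frac-/(_ idE) Eab.
have /IM[Ia|Ib] : I (a * b) by rewrite -cE.
  by left; apply/ideal_frac => //; exact: extension_to_loc.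
by right; apply/ideal_frac => //; exact: extension_to_loc.
Qed.

Lemma extension_proper I J : prime_ideal I -> prime_ideal J -> I `<=` P -> J `<=` P ->
  I `<` J -> extension I `<` extension J.
Proof.
move=> pI pJ IP JP [IJ nJI]; split.
  by move=> _ [a [s [Ss [Ia ->]]]]; exists a, s, Ss; split=> //; exact: IJ.
move=> sJI; apply: nJI => a Ja.
by rewrite -(contraction_extension pI IP); apply: sJI; exact: extension_to_loc.
Qed.

Lemma loc_maximal N : maximal_ideal N <-> N = extension P.
Proof.
have [idE nE1 _] := extension_prime pP (@subset_refl _ P).
have top K : is_ideal K -> ~ K 1 -> K `<=` extension P.
  move=> idK nK1; apply: contraction_sub => //.
  rewrite (contraction_extension pP) //; exact: contraction_below.
split=> [[idN nN1 maxN]|->]; first by rewrite (maxN (extension P)) //; exact: top.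
by split=> // K idK nK1 EK; apply/seteqP; split=> //; exact: top.
Qed.

Lemma loc_noetherian : noetherian R -> noetherian L.
Proof.
move=> noethR K idK; have [s es] := noethR _ (contraction_ideal idK).
exists (map to_L s : seq L).
have idS := ideal_span_ideal ([set` (map to_L s : seq L)] : set L).
apply/seteqP; split.
  apply: contraction_sub => //; rewrite es; apply: smallest_sub.
    exact: contraction_ideal.
  move=> a /= sa; apply: sub_gen_smallest => /=; exact: map_f.
apply: smallest_sub => // z /= /mapP[a sa ->].
have : contraction K a by rewrite es; apply: sub_gen_smallest.
by [].
Qed.

End LocalizationAtAPrime.

Arguments extension {R P} pP I.

Section SmallSpans.

Variable R : comPzRingType.

Lemma ideal_span0 : ideal_span [set` [::] : seq R] = [set 0 : R].
Proof.
apply/seteqP; split; first by apply: smallest_sub; [exact: zero_ideal | move=> x].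
by move=> x /= ->; have [] := ideal_span_ideal ([set` [::] : seq R]).
Qed.

Lemma ideal_span1 (a : R) : ideal_span [set` [:: a]] = principal a.
Proof.
apply/seteqP; split.
  apply: smallest_sub; first exact: principal_ideal.
  by move=> x /=; rewrite inE => /eqP ->; exact: mem_principal.
apply: principal_sub; first exact: ideal_span_ideal.
by apply: sub_gen_smallest => /=; rewrite inE.
Qed.

End SmallSpans.

Section CohenMacaulay.

Variable R : comPzRingType.
Hypothesis noethR : noetherian R.

Definition maximals_regular := forall M : set R, maximal_ideal M ->
  exists2 t, M t & GRing.lreg t.

Lemma loc_lreg P (pP : prime_ideal P) (t : R) : GRing.lreg t ->
  GRing.lreg (to_loc (prime_compl pP) t : loc_at pP).
Proof.
move=> tr y z; have [a [s [Ss ->]]] := fracP y; have [b [r [Sr ->]]] := fracP z.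
rewrite /to_loc ![X in X = _ -> _](loc_mulE _ _ _ _) ![X in _ = X -> _](loc_mulE _ _ _ _).
move=> /frac_eq[u Su e]; apply/frac_eq; exists u => //.
by apply: tr; move: e; rewrite !mul1r => e; transitivity (u * (t * a * r));
  [ring | rewrite e; ring].
Qed.

(** Let [t] be a regular element of the maximal ideal of a localization. A prime
    that avoids the powers of [t] gives a chain of length one. For the depth,
    [t] is a regular sequence, and no regular sequence starts with two elements
    [a], [b]: the maximal ideal is the only prime that contains [a], so some
    power of [b] is a multiple of [a], and as [b] is regular modulo [a], so is
    [1]. *)
Lemma locally_cm_dim1_of : maximals_regular -> no_three_primes R -> locally_cm_dim1 R.
Proof.
move=> maxreg n3 M maxM; set pM := maximal_ideal_prime maxM.
set L := loc_at pM; have noethL : noetherian L by exact: loc_noetherian.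
have n3L : no_three_primes L.
  move=> K0 K1 K2 p0 p1 p2 s01 s12.
  have [i0 _ _] := p0; have [i1 _ _] := p1; have [i2 _ _] := p2.
  apply: (n3 (contraction K0) (contraction K1) (contraction K2));
    by [exact: contraction_prime | exact: contraction_proper].
pose N : set L := extension pM M.
have pN : prime_ideal N by apply: extension_prime.
have [idN nN1 _] := pN.
have maxN : maximal_ideal N by apply/loc_maximal.
have [t0 Mt t0reg] := maxreg M maxM.
pose t : L := to_loc (prime_compl pM) t0.
have Nt : N t by exact: extension_to_loc.
have treg : GRing.lreg t by exact: loc_lreg.
split=> //; exists N; split; first by move=> N'; rewrite loc_maximal.
- split=> [|n p [pp sp]]; last first.
    rewrite leqNgt; apply/negP => n2; apply: (n3L (p 0%N) (p 1%N) (p 2%N)).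
    + by apply: pp.
    + by apply: pp; rewrite ltnW.
    + exact: pp.
    + by apply: sp; rewrite ltnW.
    + exact: sp.
  have [x /= -> [k _ tk]|Q [pQ _ Qt]] :=
      prime_avoiding noethL (zero_ideal L) (powers_mult_set t).
    apply: nN1; suff -> : 1 = 0 :> L by have [] := idN.
    by apply: (@lregX _ t k treg); rewrite mulr0 mulr1.
  have QN : Q `<=` N.
    have [idQ nQ1 _] := pQ; have [N' maxN' QN'] := maximal_above noethL idQ nQ1.
    by have /loc_maximal eN' := maxN'; rewrite /N -eN'.
  exists (fun i => if i is 0%N then Q else N); split; first by case.
  case=> // _; split=> // NQ; apply: (Qt t); last by exists 1%N.
  exact: NQ.
- split.
    exists [:: t]; split=> // [|x /=]; last by rewrite inE => /eqP ->.
    split=> [[|//] _ x /=|].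
      by rewrite ideal_span0 /= -[in RHS](mulr0 t) => /treg.
    rewrite ideal_span1 => N1; apply: nN1; exact: principal_sub N1.
  case=> [//|a [//|b s]] [reg nspan] sN; exfalso.
  have Na : N a by apply: sN; rewrite /= inE eqxx.
  have Nb : N b by apply: sN; rewrite /= !inE eqxx orbT.
  have areg : GRing.lreg a.
    move=> x y e; apply/eqP; rewrite -subr_eq0; apply/eqP.
    have := reg 0%N isT (x - y); rewrite /= ideal_span0 /=; apply.
    by rewrite mulrBr e subrr.
  have breg x : principal a (b * x) -> principal a x.
    by have := reg 1%N isT x; rewrite /= ?take0 ideal_span1.
  have bpow n : principal a (b ^+ n) -> principal a 1.
    elim: n => [|n IH]; first by rewrite expr0.
    by rewrite exprS => /breg.
  have [n abn] : exists n, principal a (b ^+ n).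
    apply: contrapT => none.
    have [|Q [pQ aQ Qb]] := prime_avoiding noethL (principal_ideal a) (powers_mult_set b).
      by move=> x ax [n _ bx]; apply: none; exists n; rewrite bx.
    have QN : Q `<=` N.
      have [idQ nQ1 _] := pQ; have [N' maxN' QN'] := maximal_above noethL idQ nQ1.
      by have /loc_maximal eN' := maxN'; rewrite /N -eN'.
    have eQN := regular_prime_maximal noethL n3L areg pQ (aQ _ (mem_principal a)) pN QN.
    by apply: (Qb b); [rewrite eQN | exists 1%N].
  by apply: nN1; apply: principal_sub (bpow _ abn).
Qed.

Hypothesis cmR : locally_cm_dim1 R.

Lemma cm_dim1_no_three_primes : no_three_primes R.
Proof.
move=> P0 P1 P2 p0 p1 p2 s01 s12; have [i2 n2 _] := p2.
have [M maxM s2M] := maximal_above noethR i2 n2.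
pose pM := maximal_ideal_prime maxM.
have [_ [N [_ [_ dimle] _]]] := cmR maxM.
have s1M : P1 `<=` M by apply: subset_trans s2M; case: s12.
have s0M : P0 `<=` M by apply: subset_trans s1M; case: s01.
pose p i := extension pM (if i is 0%N then P0 else if i is 1%N then P1 else P2).
have /dimle // : prime_chain 2 p.
split=> [[|[|[|//]]]|[|[|//]]] _; rewrite /p; by [exact: extension_prime | exact: extension_proper].
Qed.

(** In the localization at [M] the image of [y] is nonzero and killed by the
    maximal ideal, so the depth would be zero. *)
Lemma annihilator_not_maximal (M : set R) (y : R) : maximal_ideal M -> 
  (forall x, M x <-> x * y = 0) -> False.
Proof.
move=> maxM ann; pose pM := maximal_ideal_prime maxM.
have [_ [N [onlyN _ [[s [[reg _] sN ss]] _]]]] := cmR maxM.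
have maxN : maximal_ideal N by apply/onlyN.
case: s reg sN ss => [//|g [|//]] reg sN _.
have /loc_maximal eN := maxN.
have [a [r [Sr [Ma eg]]]] : extension pM M g by rewrite -eN; apply: sN; rewrite /= inE eqxx.
have := reg 0%N isT (to_loc (prime_compl pM) y); rewrite /= ideal_span0 /= => h.
have /h/frac_eq[] : g * to_loc (prime_compl pM) y = 0 :> loc_at pM.
  rewrite eg [LHS]loc_mulE; apply: frac_congr; rewrite ((ann a).1 Ma); ring.
move=> u /mem_prime_compl Pu; rewrite mulr1 mul0r mulr0 => uy; apply: Pu.
exact/ann.
Qed.

End CohenMacaulay.

(** * Regular elements in maximal ideals *)

Section RegularElements.

Variable R : comPzRingType.
Hypothesis noethR : noetherian R.

(** A maximal one among the annihilators of nonzero elements that contain [z] is prime. *)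
Lemma zero_divisor_annihilator (z : R) : ~ GRing.lreg z ->
  exists P y, [/\ prime_ideal P, P z & forall x, P x <-> x * y = 0].
Proof.
move=> nreg.
have [y0 [y0nz zy0]] : exists y, y <> 0 /\ z * y = 0.
  apply: contrapT => none; apply: nreg => u v e; apply/eqP; rewrite -subr_eq0.
  apply/eqP; apply: contrapT => ne; apply: none; exists (u - v); split=> //.
  by rewrite mulrBr e subrr.
pose G J := exists y, [/\ y <> 0, J = [set x | x * y = 0] & J z].
have [J [y [_ -> _]]||P [[y [ynz eP Pz]] maxP]] := maximal_ideal_in noethR (G := G).
- split=> /=; first by rewrite mul0r.
    by move=> u v eu ev; rewrite mulrDl eu ev addr0.
  by move=> a u eu; rewrite -mulrA eu mulr0.
- by exists [set x | x * y0 = 0], y0.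
exists P, y; split=> //; last by move=> x; rewrite eP.
split.
- rewrite eP; split=> /=; first by rewrite mul0r.
    by move=> u v eu ev; rewrite mulrDl eu ev addr0.
  by move=> a u eu; rewrite -mulrA eu mulr0.
- by rewrite eP /= mul1r.
move=> u v; rewrite {1}eP /= => uvy; have [uy|uynz] := pselect (u * y = 0); first by left; rewrite eP.
right; have <- /= : [set x | x * (u * y) = 0] = P.
  apply: maxP; last by rewrite eP => x /= xy; rewrite mulrCA xy mulr0.
  exists (u * y); split=> //=.
  by move: Pz; rewrite eP /= => zy; rewrite mulrCA zy mulr0.
by rewrite mulrCA mulrA.
Qed.

(** Since the primes are incomparable, an element of [M] that avoids all but one
    of them can be corrected by an element of [M] that lies in all the others
    and not in that one. *)
Lemma prime_avoidance (M : set R) (s : seq (set R)) : is_ideal M ->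
  (forall P, P \in s -> prime_ideal P /\ ~ M `<=` P) ->
  (forall P Q, P \in s -> Q \in s -> P `<=` Q -> P = Q) ->
  exists a, M a /\ forall P, P \in s -> ~ P a.
Proof.
move=> idM; have [M0 MD MZ] := idM.
elim: s => [_ _|P s IH sP inc]; first by exists 0.
have [||a [Ma sa]] := IH.
- by move=> Q sQ; apply: sP; rewrite inE sQ orbT.
- by move=> Q Q' sQ sQ'; apply: inc; rewrite inE ?sQ ?sQ' orbT.
have [[idP P1 PM] nMP] : prime_ideal P /\ ~ M `<=` P by apply: sP; rewrite mem_head.
have [Pa|nPa] := pselect (P a); last first.
  by exists a; split=> // Q; rewrite inE => /predU1P[->|/sa].
have [Ps|nPs] := boolP (P \in s); first by case: (sa _ Ps).
have [b [Mb nPb sb]] : exists b, [/\ M b, ~ P b & forall Q, Q \in s -> Q b].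
  have : forall Q, Q \in s -> exists2 c, Q c & ~ P c.
    move=> Q sQ; apply: contrapT => none; move/negP: nPs; apply.
    rewrite -(inc Q P) ?mem_head ?inE ?sQ ?orbT // => c Qc.
    by apply: contrapT => nPc; apply: none; exists c.
  have {IH sa sP inc Pa Ma a nPs} : forall Q, Q \in s -> is_ideal Q.
    by move=> Q sQ; have [|[]] := sP Q; first by rewrite inE sQ orbT.
  elim: s => [_ _|Q s IH ids wit].
    apply: contrapT => none; apply: nMP => c Mc.
    by apply: contrapT => nPc; apply: none; exists c; split.
  have [||b [Mb nPb sb]] := IH.
  - by move=> Q' sQ'; apply: ids; rewrite inE sQ' orbT.
  - by move=> Q' sQ'; apply: wit; rewrite inE sQ' orbT.
  have [c Qc nPc] := wit _ (mem_head Q s); have [_ _ QZ] := ids _ (mem_head Q s).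
  exists (b * c); split; first by rewrite mulrC; exact: MZ.
    by move=> /PM[].
  move=> Q'; rewrite inE => /predU1P[->|sQ']; first exact: QZ.
  have [_ _ Q'Z] : is_ideal Q' by apply: ids; rewrite inE sQ' orbT.
  by rewrite mulrC; apply: Q'Z; exact: sb.
exists (a + b); split; first exact: MD.
move=> Q; rewrite inE => /predU1P[->|sQ] Qab.
  by apply: nPb; rewrite -[b](addKr a) addrC; apply: idealB.
apply: (sa Q sQ); rewrite -[a](addrK b); apply: idealB => //; last exact: sb.
by have [|[]] := sP Q; first by rewrite inE sQ orbT.
Qed.

(** A zero divisor lies in a prime annihilator. That prime is not maximal, by
    the depth of the localizations; hence it is minimal, by their dimension. So
    the zero divisors lie in finitely many minimal primes that are not maximal,
    and prime avoidance gives an element of [M] outside all of them. *)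
Lemma cm_dim1_maximals_regular : locally_cm_dim1 R -> maximals_regular R.
Proof.
move=> cmR M maxM; have n3 := cm_dim1_no_three_primes noethR cmR.
have [F0 [/finite_seqP[s es] FP Fmin]] := finite_primes_below noethR (zero_ideal R).
have sF (P : set R) : P \in s = F0 P :> Prop by rewrite es.
have [idM nM1 _] := maxM.
(* the non-maximal primes, which are minimal as there is no chain of three primes *)
pose s' := [seq P <- s | `[< ~ maximal_ideal P >]].
have s'P (P : set R) : P \in s' -> [/\ prime_ideal P, F0 P & ~ maximal_ideal P].
  rewrite mem_filter => /andP[/asboolP nmP sP].
  have FP0 : F0 P by rewrite -sF.
  by have [] := FP P FP0.
have minimal (P Q : set R) : prime_ideal P -> prime_ideal Q -> ~ maximal_ideal Q -> P `<=` Q -> P = Q.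
  move=> pP pQ nmQ PQ; apply: contrapT => ne.
  have [idQ nQ1 _] := pQ; have [N maxN QN] := maximal_above noethR idQ nQ1.
  apply: (n3 P Q N) => //; first exact: maximal_ideal_prime.
    by split=> // QP; apply: ne; apply/seteqP.
  by split=> // NQ; apply: nmQ; have -> : Q = N by apply/seteqP.
have [||t [Mt s't]] := prime_avoidance (s := s') idM.
- move=> P /s'P[pP _ nmP]; split=> // MP; apply: nmP.
  have [idP nP1 _] := pP; by rewrite (maximal_sub_eq maxM idP nP1 MP).
- by move=> P Q /s'P[pP _ _] /s'P[pQ _ nmQ]; exact: minimal.
exists t => //; apply: contrapT => /zero_divisor_annihilator[P [y [pP Pt ann]]].
have nmP : ~ maximal_ideal P.
  by move=> maxP; apply: (annihilator_not_maximal cmR maxP ann).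
have [|Q FQ QP] := Fmin P pP; first by move=> x ->; have [[]] := pP.
have [pQ _] := FP Q FQ; have eQ := minimal Q P pQ pP nmP QP.
apply: (s't P) => //; rewrite mem_filter; apply/andP; split; first exact/asboolP.
by rewrite sF -eQ.
Qed.

(** The finitely many primes below those containing [t] contain [t] themselves,
    so they are maximal. *)
Lemma semilocal_of_regular (t : R) : no_three_primes R -> GRing.lreg t ->
  (forall M : set R, maximal_ideal M -> M t) -> semilocal R.
Proof.
move=> n3 treg Mt.
have [F [finF FP Fmin]] := finite_primes_below noethR (principal_ideal t).
apply: sub_finite_set finF => M maxM.
have [idM nM1 _] := maxM; have pM := maximal_ideal_prime maxM.
have [|Q FQ QM] := Fmin M pM; first by apply: principal_sub => //; exact: Mt.
have [pQ tQ] := FP Q FQ.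
by rewrite -(regular_prime_maximal noethR n3 treg pQ (tQ _ (mem_principal t)) pM QM).
Qed.

Lemma jacobson_regular : semilocal R -> maximals_regular R ->
  exists2 t, GRing.lreg t & forall M : set R, maximal_ideal M -> M t.
Proof.
move=> /finite_seqP[s es] maxreg.
have smax M : M \in s -> maximal_ideal M by move=> sM; have : [set` s] M by []; rewrite -es.
have [t treg st] : exists2 t : R, GRing.lreg t & forall M, M \in s -> M t.
  elim: s smax {es} => [_|M s IH smax]; first by exists 1 => //; exact: lreg1.
  have [|t treg st] := IH; first by move=> N sN; apply: smax; rewrite inE sN orbT.
  have [u Mu ureg] := maxreg M (smax _ (mem_head _ _)).
  exists (t * u); first exact: lregM.
  move=> N; rewrite inE => /predU1P[->|sN].
    by have [[_ _ MZ] _ _] := smax _ (mem_head M s); exact: MZ.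
  have [[_ _ NZ] _ _] : maximal_ideal N by apply: smax; rewrite inE sN orbT.
  by rewrite mulrC; apply: NZ; exact: st.
exists t => // M maxM; apply: st.
by have : [set M | maximal_ideal M] M by []; rewrite es.
Qed.

End RegularElements.

(** * Noetherian modules *)

Section NoetherianModules.

Variables (R : comNzRingType) (V : lmodType R).

Definition is_submodule (N : set V) :=
  [/\ N 0, forall x y, N x -> N y -> N (x + y) & forall a x, N x -> N (a *: x)].

Definition span (X : set V) : set V := smallest is_submodule X.

Lemma span_submodule X : is_submodule (span X).
Proof.
split=> [J [[J0 _ _] _] //|x y Sx Sy J JX|a x Sx J JX].
  by have [[_ JD _] _] := JX; apply: JD; [exact: Sx | exact: Sy].
by have [[_ _ JZ] _] := JX; apply: JZ; exact: Sx.
Qed.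

Lemma submoduleB N x y : is_submodule N -> N x -> N y -> N (x - y).
Proof. by case=> _ ND NZ Nx Ny; rewrite -scaleN1r; apply: ND => //; exact: NZ. Qed.

Lemma submodule_sum (T : Type) (r : seq T) (Q : pred T) (F : T -> V) N :
  is_submodule N -> (forall i, Q i -> N (F i)) -> N (\sum_(i <- r | Q i) F i).
Proof. by move=> [N0 ND _] NF; elim/big_ind: _. Qed.

Lemma submodule_chain (F : nat -> set V) : (forall n, is_submodule (F n)) ->
  (forall n, F n `<=` F n.+1) -> is_submodule (\bigcup_n F n).
Proof.
move=> idF FS.
have Fmono m n := @chain_mono _ F FS m n.
split; first by exists 0%N => //; have [] := idF 0%N.
  move=> x y [m _ Fx] [n _ Fy]; exists (maxn m n) => //.
  have [_ + _] := idF (maxn m n); apply.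
    exact: (Fmono m) (leq_maxl _ _) _ Fx.
  exact: (Fmono n) (leq_maxr _ _) _ Fy.
by move=> a x [n _ Fx]; exists n => //; have [_ _] := idF n; apply.
Qed.

Definition fin_gen_submodule (N : set V) := exists s : seq V, N = span [set` s].

Lemma span_cons e (l : seq V) x : span [set` e :: l] x ->
  exists c : R, span [set` l] (x - c *: e).
Proof.
have [S0 SD SZ] := span_submodule [set` l].
move: x; apply: (@smallest_sub _ is_submodule _
  [set x | exists c : R, span [set` l] (x - c *: e)]).
  split=> /=; first by exists 0; rewrite scale0r subr0.
    move=> x y [c Sc] [d Sd]; exists (c + d).
    by rewrite scalerDl opprD addrACA; exact: SD.
  by move=> a x [c Sc]; exists (a * c); rewrite -scalerA -scalerBr; exact: SZ.
move=> x; rewrite /= inE => /predU1P[->|lx].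
  by exists 1; rewrite scale1r subrr.
by exists 0; rewrite scale0r subr0; apply: sub_gen_smallest.
Qed.

Lemma submodule_of_span_fin_gen (l : seq V) N : noetherian R -> is_submodule N ->
  N `<=` span [set` l] -> fin_gen_submodule N.
Proof.
move=> noethR; elim: l N => [|e l IH] N subN Nl.
  exists [::]; apply/seteqP; split=> //.
  by apply: smallest_sub => // x.
have [N0 ND NZ] := subN.
have [S0 SD SZ] := span_submodule [set` l].
(* the coefficients of e in the elements of N form an ideal *)
pose I : set R := [set c | exists2 x, N x & span [set` l] (x - c *: e)].
have idI : is_ideal I.
  split; first by exists 0 => //; rewrite scale0r subr0.
    move=> c d [x Nx Sx] [y Ny Sy]; exists (x + y); first exact: ND.
    by rewrite scalerDl opprD addrACA; exact: SD.
  move=> a c [x Nx Sx]; exists (a *: x); first exact: NZ.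
  by rewrite -scalerA -scalerBr; exact: SZ.
have [cs ecs] := noethR _ idI.
have [|s es] := IH (N `&` span [set` l]) _ (@subIsetr _ _ _).
  split; first by split.
    by move=> x y [Nx Sx] [Ny Sy]; split; [exact: ND | exact: SD].
  by move=> a x [Nx Sx]; split; [exact: NZ | exact: SZ].
have lift c : exists x, I c -> N x /\ span [set` l] (x - c *: e).
  by have [[x Nx Sx]|nI] := pselect (I c); [exists x | exists 0].
have [f fP] := choice lift.
exists (map f cs ++ s); set T := span _.
have [T0 TD TZ] := span_submodule [set` map f cs ++ s].
have csI c : c \in cs -> I c by move=> csc; rewrite ecs; apply: sub_gen_smallest.
apply/seteqP; split; last first.
  apply: smallest_sub => // x /=; rewrite mem_cat => /orP[/mapP[c /csI Ic ->]|sx].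
    by have [] := fP c Ic.
  suff [] : (N `&` span [set` l]) x by [].
  by rewrite es; apply: sub_gen_smallest.
have sT : N `&` span [set` l] `<=` T.
  rewrite es; apply: smallest_sub; first exact: span_submodule.
  by move=> x /= sx; apply: sub_gen_smallest; rewrite /= mem_cat sx orbT.
(* modulo span l, an element of N is determined by its coefficient at e *)
have lead c : I c -> exists2 y, N y /\ T y & span [set` l] (y - c *: e).
  move=> Ic; have : ideal_span [set` cs] c by rewrite -ecs.
  move: {Ic} c; apply: (@smallest_sub _ (@is_ideal R) _
    [set c | exists2 y, N y /\ T y & span [set` l] (y - c *: e)]).
    split=> /=; first by exists 0 => //; rewrite scale0r subr0.
      move=> c d [x [Nx Tx] Sx] [y [Ny Ty] Sy]; exists (x + y).
        by split; [exact: ND | exact: TD].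
      by rewrite scalerDl opprD addrACA; exact: SD.
    move=> a c [x [Nx Tx] Sx]; exists (a *: x).
      by split; [exact: NZ | exact: TZ].
    by rewrite -scalerA -scalerBr; exact: SZ.
  move=> c /= csc; have [Nf Sf] := fP c (csI c csc).
  exists (f c) => //; split=> //; apply: sub_gen_smallest.
  by rewrite /= mem_cat map_f.
move=> x Nx; have [c Sc] := span_cons (Nl x Nx).
have [|y [Ny Ty] Sy] := lead c; first by exists x.
rewrite -[x](subrK y); apply: TD => //; apply: sT; split.
  exact: submoduleB.
have -> : x - y = (x - c *: e) - (y - c *: e) by rewrite opprB addrA subrK.
exact: (submoduleB (span_submodule _) Sc Sy).
Qed.

Lemma submodules_fin_gen : noetherian R -> finitely_generated V ->
  forall N, is_submodule N -> fin_gen_submodule N.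
Proof.
move=> noethR [n [e eP]] N subN.
apply: (@submodule_of_span_fin_gen [seq e i | i <- enum 'I_n]) => // x _.
have [c ->] := eP x; apply: submodule_sum => [|i _]; first exact: span_submodule.
have [_ _ SZ] := span_submodule [set` [seq e i | i <- enum 'I_n]].
by apply: SZ; apply: sub_gen_smallest => /=; rewrite map_f ?mem_enum.
Qed.

Section Noetherian.

Hypothesis noethV : forall N, is_submodule N -> fin_gen_submodule N.

Lemma maximal_submodule_in (G : set V -> Prop) :
  (forall N, G N -> is_submodule N) -> (exists N, G N) ->
  exists N, G N /\ forall N', G N' -> N `<=` N' -> N' = N.
Proof. by apply: maximal_member; [exact: noethV | exact: submodule_chain]. Qed.

Lemma submodule_induction (Q : set V -> Prop) :
  (forall N, is_submodule N ->
     (forall N', is_submodule N' -> N `<=` N' -> N' <> N -> Q N') -> Q N) ->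
  forall N, is_submodule N -> Q N.
Proof. by apply: noetherian_induction; [exact: noethV | exact: submodule_chain]. Qed.

Lemma submodules_stabilize (F : nat -> set V) : (forall n, is_submodule (F n)) ->
  (forall n, F n `<=` F n.+1) -> exists n, F n.+1 = F n.
Proof.
move=> subF FS.
have [_ [n ->]||N [[n ->] maxF]] := @maximal_submodule_in (fun N => exists n, N = F n).
- exact: subF.
- by exists (F 0%N), 0%N.
by exists n; apply: maxF; [exists n.+1 | exact: FS].
Qed.

End Noetherian.

End NoetherianModules.

(** * Total fractions, and rings between [A] and its integral closure *)

Lemma lreg_eq0P (R : pzRingType) (a : R) : GRing.lreg a <-> forall z, a * z = 0 -> z = 0.
Proof.
split=> [areg z az|areg x y e]; first by apply: areg; rewrite az mulr0.
by apply/eqP; rewrite -subr_eq0; apply/eqP/areg; rewrite mulrBr e subrr.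
Qed.

Lemma lreg_factor (R : comPzRingType) (a b : R) : GRing.lreg (a * b) -> GRing.lreg a.
Proof.
move=> reg x y e; apply: reg.
by rewrite ![a * b]mulrC -!mulrA e.
Qed.

Lemma integralOverE (R K : comNzRingType) (f : {rmorphism R -> K}) (x : K) :
  integralOver f x <->
  exists n (a : nat -> R), x ^+ n + \sum_(i < n) f (a i) * x ^+ i = 0.
Proof.
split=> [[p pmon /rootP px]|[n [a e]]].
  have sp : (0 < size p)%N by rewrite size_poly_gt0 monic_neq0.
  set n := (size p).-1; have sn : size p = n.+1 by rewrite prednK.
  have lead : p`_n = 1 by rewrite -(monicP pmon).
  exists n, (fun i => p`_i); rewrite -[RHS]px horner_coef size_map_poly_id0; last first.
    by rewrite (monicP pmon) rmorph1 oner_neq0.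
  rewrite sn big_ord_recr /= [RHS]addrC [X in _ = X * _ + _]coef_map /= lead rmorph1 mul1r.
  congr (_ + _).
  by apply: eq_bigr => i _; rewrite coef_map.
exists ('X^n + \poly_(i < n) a i).
  by rewrite monicE lead_coefDl ?lead_coefXn // size_polyXn ltnS size_poly.
apply/rootP; rewrite rmorphD /= map_polyXn hornerD hornerXn -[RHS]e; congr (_ + _).
rewrite (@horner_coef_wide _ n); last first.
  by rewrite (leq_trans (size_poly _ _)) // size_poly.
by apply: eq_bigr => i _; rewrite coef_map coef_poly ltn_ord.
Qed.

Section TotalFractionRing.

Variable A : comNzRingType.
Local Notation Q := (total_frac A).
Local Notation B := (integral_closure A).
Local Notation iota := (@to_closure A).

(** A named copy of the inclusion, so that rewriting does not
    unfold the subtype. *)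
Definition closure_frac (x : B) : Q := subring_val x.

Lemma closure_frac_zmod_morphism : zmod_morphism closure_frac.
Proof. by []. Qed.

Lemma closure_frac_monoid_morphism : monoid_morphism closure_frac.
Proof. by []. Qed.

HB.instance Definition _ :=
  GRing.isZmodMorphism.Build B Q closure_frac closure_frac_zmod_morphism.
HB.instance Definition _ :=
  GRing.isMonoidMorphism.Build B Q closure_frac closure_frac_monoid_morphism.

Lemma closure_frac_inj : injective closure_frac.
Proof. by move=> x y e; apply: val_inj. Qed.

Lemma closure_frac_iota a : closure_frac (iota a) = to_frac a.
Proof. by []. Qed.

Lemma to_frac_inj : injective (@to_frac A).
Proof.
move=> a b /frac_eq[u /asboolP ureg]; rewrite !mulr1; exact: ureg.
Qed.

Lemma to_frac_unit (s : A) : GRing.lreg s -> exists q : Q, to_frac s * q = 1.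
Proof.
move=> sreg; have Ss : s \in nzd A by apply/asboolP.
by exists (frac 1 Ss); exact: to_loc_unit.
Qed.

Lemma total_fracP (q : Q) : exists s a, GRing.lreg s /\ to_frac s * q = to_frac a.
Proof.
have [a [s [Ss ->]]] := fracP q; exists s, a; split; first exact/asboolP.
by rewrite /to_frac -to_loc_frac.
Qed.

Lemma iota_inj : injective iota.
Proof. by move=> a b [] /to_frac_inj. Qed.

Lemma closure_scaleE (a : A) (x : B) : a *: x = iota a * x.
Proof. by []. Qed.

Lemma closureP (x : B) : exists s a, GRing.lreg s /\ iota s * x = iota a.
Proof.
have [s [a [sreg e]]] := total_fracP (closure_frac x).
by exists s, a; split=> //; apply: closure_frac_inj; rewrite rmorphM.
Qed.

Lemma closure_lreg_of_unit (x : B) (q : Q) : closure_frac x * q = 1 -> GRing.lreg x.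
Proof.
move=> xq; apply/lreg_eq0P => z /(congr1 closure_frac); rewrite rmorphM rmorph0 => e.
apply: closure_frac_inj; rewrite rmorph0.
by rewrite -[LHS]mul1r -xq mulrAC e mul0r.
Qed.

Lemma iota_lreg (s : A) : GRing.lreg s -> GRing.lreg (iota s).
Proof. by move=> /to_frac_unit[q sq]; apply: (@closure_lreg_of_unit _ q). Qed.

Lemma closure_lregP (x : B) : GRing.lreg x ->
  exists s a, [/\ GRing.lreg s, GRing.lreg a & iota s * x = iota a].
Proof.
move=> xreg; have [s [a [sreg e]]] := closureP x; exists s, a; split=> //.
have /lreg_eq0P areg : GRing.lreg (iota a) by rewrite -e; apply: lregM => //; exact: iota_lreg.
apply/lreg_eq0P => z az; apply: iota_inj; rewrite rmorph0; apply: areg.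
by rewrite -rmorphM az rmorph0.
Qed.

Lemma closure_lreg_unit (x : B) : GRing.lreg x -> exists q : Q, closure_frac x * q = 1.
Proof.
move=> /closure_lregP[s [a [_ /to_frac_unit[q aq] e]]]; exists (q * to_frac s).
rewrite mulrCA [closure_frac x * _]mulrC.
by rewrite -closure_frac_iota -rmorphM e mulrC.
Qed.

Lemma mem_closureP (q : Q) : integralOver to_frac q -> exists x : B, closure_frac x = q.
Proof.
move=> qint; have Bq : q \in @integral_pred A by apply/asboolP.
by exists (SubringElt Bq).
Qed.

Lemma closure_frac_integral (x : B) : integralOver to_frac (closure_frac x).
Proof. exact/asboolP/(valP x). Qed.

Lemma closure_integral (x : B) :
  exists n (a : nat -> A), x ^+ n + \sum_(i < n) iota (a i) * x ^+ i = 0.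
Proof.
have /integralOverE[n [a e]] := closure_frac_integral x.
exists n, a; apply: closure_frac_inj.
rewrite rmorphD rmorphXn rmorph_sum rmorph0 -[RHS]e; congr (_ + _).
by apply: eq_bigr => i _; rewrite rmorphM rmorphXn.
Qed.

End TotalFractionRing.

(** [S] is a ring between [A] and its integral closure. The maps are kept
    explicit because [S] is in turn the integral closure itself and a subring
    of it. *)
Section IntermediateRing.

Variables (A S : comNzRingType) (phi : {rmorphism A -> S}).
Variable psi : {rmorphism S -> integral_closure A}.
Hypotheses (psi_inj : injective psi) (psi_phi : forall a, psi (phi a) = to_closure a).
Local Notation B := (integral_closure A).
Local Notation iota := (@to_closure A).

Lemma intermediate_lreg (s : A) : GRing.lreg s -> GRing.lreg (phi s).
Proof.
move=> sreg; apply/lreg_eq0P => z sz; apply: psi_inj; rewrite rmorph0.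
by apply: (iota_lreg sreg); rewrite -psi_phi -rmorphM sz rmorph0 mulr0.
Qed.

Lemma lreg_closure (x : S) : GRing.lreg x -> GRing.lreg (psi x).
Proof.
move=> /lreg_eq0P xreg; apply/lreg_eq0P => z xz.
have [s [a [sreg e]]] := closureP z.
apply: (iota_lreg sreg); rewrite e mulr0 -psi_phi.
rewrite (xreg (phi a)) ?rmorph0 //; apply: psi_inj.
by rewrite rmorphM rmorph0 psi_phi -e mulrCA xz mulr0.
Qed.

Lemma closure_lreg_intermediate (x : S) : GRing.lreg (psi x) -> GRing.lreg x.
Proof.
move=> /lreg_eq0P xreg; apply/lreg_eq0P => z xz; apply: psi_inj; rewrite rmorph0.
by apply: xreg; rewrite -rmorphM xz rmorph0.
Qed.

Lemma intermediate_integral (x : S) :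
  exists n (a : nat -> A), x ^+ n + \sum_(i < n) phi (a i) * x ^+ i = 0.
Proof.
have [n [a e]] := closure_integral (psi x); exists n, a; apply: psi_inj.
rewrite rmorph0 rmorphD rmorphXn rmorph_sum -[RHS]e; congr (_ + _).
by apply: eq_bigr => i _; rewrite rmorphM rmorphXn psi_phi.
Qed.

Definition below (P : set S) : set A := [set a | P (phi a)].

Lemma below_ideal P : is_ideal P -> is_ideal (below P).
Proof.
case=> P0 PD PZ; rewrite /below; split=> /=.
- by rewrite rmorph0.
- by move=> x y Px Py; rewrite rmorphD; exact: PD.
- by move=> a x Px; rewrite rmorphM; exact: PZ.
Qed.

Lemma below_prime P : prime_ideal P -> prime_ideal (below P).
Proof.
case=> idP P1 PM; split; first exact: below_ideal.
- by rewrite /below /= rmorph1.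
- by move=> x y; rewrite /below /= rmorphM => /PM.
Qed.

(** In the monic equation of an element of [P'] outside [P], strip off the
    powers of the element; some coefficient then separates [P'] from [P]. *)
Lemma incomparability P P' : prime_ideal P -> is_ideal P' -> P `<` P' ->
  below P `<` below P'.
Proof.
move=> [idP P1 PM] idP' [PP' nP'P]; split; first by move=> a; exact: PP'.
move=> bsub; apply: nP'P => x P'x; apply: contrapT => nPx.
have [_ _ PZ] := idP; have [_ _ P'Z] := idP'.
have [n [a e]] := intermediate_integral x.
have : P (x ^+ n + \sum_(i < n) phi (a i) * x ^+ i) by rewrite e; have [] := idP.
elim: n a {e} => [|n IH] a; first by rewrite big_ord0 addr0 expr0 => /P1.
rewrite big_ord_recl expr0 mulr1 exprS.
pose r := x ^+ n + \sum_(i < n) phi (a i.+1) * x ^+ i.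
have -> : x * x ^+ n + (phi (a 0%N) + \sum_(i < n) phi (a (bump 0 i)) * x ^+ bump 0 i)
   = phi (a 0%N) + x * r.
  rewrite /r addrCA mulrDr mulr_sumr; congr (_ + (_ + _)).
  by apply: eq_bigr => i _; rewrite /bump /= add1n exprS mulrCA.
move=> Pe.
have /bsub Pa : below P' (a 0%N).
  rewrite /below /= -[phi _](addrK (x * r)); apply: idealB => //; first exact: PP'.
  by rewrite mulrC; exact: P'Z.
have /PM[//|/(IH (fun i => a i.+1))//] : P (x * r).
by rewrite -[x * r](addKr (phi (a 0%N))) addrC; exact: idealB.
Qed.

(** If [x] is not in [below N], it has an inverse [y] modulo [N]. The monic
    equation of [y] over [A], multiplied by a power of [x], shows that [1] is in
    [below N + x A]. *)
Lemma below_maximal N : maximal_ideal N -> maximal_ideal (below N).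
Proof.
move=> maxN; have [idN N1 NM] := maximal_ideal_prime maxN.
have [_ _ NZ] := idN.
split; [exact: below_ideal | by rewrite /below /= rmorph1 |].
move=> J idJ nJ1 NJ; apply/seteqP; split=> // x Jx; apply: contrapT => nNx.
have [y Ny] := maximal_unitP maxN nNx.
have [n [a e]] := intermediate_integral y.
have [J0 JD JZ] := idJ.
have Nxy i : N (1 - (phi x * y) ^+ i).
  by rewrite -(expr1n _ i) subrXX mulrC; apply: NZ; rewrite [phi x * y]mulrC.
have Nc : N (phi (1 + \sum_(i < n) a i * x ^+ (n - i))).
  have -> : phi (1 + \sum_(i < n) a i * x ^+ (n - i)) =
      (1 - (phi x * y) ^+ n) +
      \sum_(i < n) phi (a i * x ^+ (n - i)) * (1 - (phi x * y) ^+ i) +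
      phi x ^+ n * (y ^+ n + \sum_(i < n) phi (a i) * y ^+ i).
    rewrite rmorphD rmorph1 rmorph_sum mulrDr -exprMn mulr_sumr.
    rewrite [RHS]addrACA subrK -big_split; congr (_ + _); apply: eq_bigr => i _ /=.
    have -> : phi x ^+ n = phi x ^+ (n - i) * phi x ^+ i by rewrite -exprD subnK // ltnW.
    by rewrite rmorphM rmorphXn exprMn; ring.
  rewrite e mulr0 addr0; have [_ ND _] := idN; apply: ND; first exact: Nxy.
  by apply: ideal_sum => // i _; apply: NZ.
apply: nJ1; rewrite -[1](addrK (\sum_(i < n) a i * x ^+ (n - i))).
apply: idealB => //; first exact: NJ.
apply: ideal_sum => // i _; apply: (JZ); rewrite -(subnSK (ltn_ord i)) exprSr.
exact: JZ.
Qed.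

Hypotheses (noethA : noetherian A) (fgB : finitely_generated B).

Lemma closure_submodules_fin_gen (N : set B) : is_submodule N -> fin_gen_submodule N.
Proof. exact: submodules_fin_gen. Qed.

(** An ideal of [S] is an [A]-submodule of the integral closure. *)
Lemma intermediate_noetherian : noetherian S.
Proof.
move=> I [I0 ID IZ].
have subI : is_submodule (psi @` I).
  split; first by exists 0; rewrite ?rmorph0.
    by move=> _ _ [x Ix <-] [y Iy <-]; exists (x + y); rewrite ?rmorphD //; exact: ID.
  move=> a _ [x Ix <-]; exists (phi a * x); first exact: IZ.
  by rewrite rmorphM psi_phi.
have [s es] := closure_submodules_fin_gen subI.
have lift y : exists x, (psi @` I) y -> I x /\ psi x = y.
  by have [[x Ix <-]|nI] := pselect ((psi @` I) y); [exists x | exists 0].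
have [f fP] := choice lift.
exists (map f s).
have sI y : y \in s -> (psi @` I) y by move=> sy; rewrite es; apply: sub_gen_smallest.
have [J0 JD JZ] := ideal_span_ideal [set` map f s].
apply/seteqP; split; last first.
  by apply: smallest_sub => // _ /= /mapP[y /sI /fP[Iy _] ->].
move=> x Ix; have : span [set` s] (psi x) by rewrite -es; exists x.
suff sub : span [set` s] `<=` psi @` (ideal_span [set` map f s]).
  by move=> /sub[y Sy /psi_inj <-].
apply: smallest_sub.
  split; first by exists 0; rewrite ?rmorph0.
    by move=> _ _ [u Su <-] [v Sv <-]; exists (u + v); rewrite ?rmorphD //; exact: JD.
  move=> a _ [u Su <-]; exists (phi a * u); first exact: JZ.
  by rewrite rmorphM psi_phi.
move=> y /= sy; exists (f y); last by have [] := fP _ (sI y sy).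
by apply: sub_gen_smallest => /=; exact: map_f.
Qed.

Hypotheses (semiA : semilocal A) (cmA : locally_cm_dim1 A).

(** By incomparability, a chain of primes of [S] stays strict in [A]. *)
Lemma intermediate_no_three_primes : no_three_primes S.
Proof.
move=> P0 P1 P2 p0 p1 p2 s01 s12.
have [i1 _ _] := p1; have [i2 _ _] := p2.
apply: (cm_dim1_no_three_primes noethA cmA (below_prime p0) (below_prime p1) (below_prime p2));
  exact: incomparability.
Qed.

Lemma intermediate_jacobson_regular :
  exists2 t, GRing.lreg t & forall N : set S, maximal_ideal N -> N (phi t).
Proof.
have [t treg tM] := jacobson_regular semiA (cm_dim1_maximals_regular noethA cmA).
by exists t => // N maxN; apply: (tM (below N)); exact: below_maximal.
Qed.

Lemma intermediate_semilocal : semilocal S.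
Proof.
have [t treg tN] := intermediate_jacobson_regular.
apply: (semilocal_of_regular intermediate_noetherian intermediate_no_three_primes) tN.
exact: intermediate_lreg.
Qed.

Lemma intermediate_cm_dim1 : locally_cm_dim1 S.
Proof.
apply: locally_cm_dim1_of; [exact: intermediate_noetherian | | exact: intermediate_no_three_primes].
move=> N maxN; have [t treg tN] := intermediate_jacobson_regular.
by exists (phi t); [exact: tN | exact: intermediate_lreg].
Qed.

End IntermediateRing.

(** * Greatest common divisors in the integral closure *)

Section CommonIdeals.

Variable R : comPzRingType.

Lemma unit_of_maximals (w : R) : noetherian R ->
  (forall M, maximal_ideal M -> ~ M w) -> exists w', w * w' = 1.
Proof.
move=> noethR nMw; apply: contrapT => nunit.
have [|M maxM wM] := maximal_above noethR (principal_ideal w).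
  by move=> [w' _ e]; apply: nunit; exists w'.
by apply: (nMw M maxM); apply: wM; exact: mem_principal.
Qed.

Lemma separate_maximals (N : set R) (s : seq (set R)) : maximal_ideal N ->
  (forall M, M \in s -> maximal_ideal M /\ M <> N) ->
  exists alpha, (forall M, M \in s -> M alpha) /\ N (1 - alpha).
Proof.
move=> maxN; have [idN nN1 _] := maxN; have [N0 ND NZ] := idN.
elim: s => [_|M s IH sM]; first by exists 1; split=> //; rewrite subrr.
have [|a [sa Na]] := IH; first by move=> M' sM'; apply: sM; rewrite inE sM' orbT.
have [maxM neM] := sM M (mem_head _ _); have [[_ _ MZ] nM1 _] := maxM.
have [x Mx nNx] : exists2 x, M x & ~ N x.
  apply: contrapT => none; apply: neM; symmetry; apply: (maximal_sub_eq maxM idN nN1).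
  by move=> x Mx; apply: contrapT => nNx; apply: none; exists x.
have [y Nyx] := maximal_unitP maxN nNx.
exists (a * (y * x)); split; last first.
  have -> : 1 - a * (y * x) = (1 - a) + a * (1 - y * x) by ring.
  by apply: ND => //; exact: NZ.
move=> M'; rewrite inE => /predU1P[->|sM']; first by do 2!apply: (MZ).
have [[[_ _ M'Z] _ _] _] : maximal_ideal M' /\ M' <> N by apply: sM; rewrite inE sM' orbT.
by rewrite mulrC; apply: M'Z; exact: sa.
Qed.

End CommonIdeals.

Section CompletelyIntegrallyClosed.

Variable R : comNzRingType.
Hypotheses (noethR : noetherian R) (no3R : no_three_primes R) (semiR : semilocal R).
Hypothesis regR : maximals_regular R.

(** As [x m] is [a (b / a) ^ m], this is complete integral closedness, stated
    without fractions. *)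
Definition almost_integrally_closed := forall (a b : R) (x : nat -> R),
  GRing.lreg a -> x 0%N = a -> (forall m, a * x m.+1 = b * x m) -> principal a b.

Hypothesis closedR : almost_integrally_closed.

(** Among the ideals [(a R : b)] contained in [N], a maximal one is prime; it
    contains the regular element [a], so it is [N]. *)
Lemma regular_colon_maximal (N : set R) (a : R) : maximal_ideal N -> N a -> GRing.lreg a ->
  exists b, ~ principal a b /\ forall r, N r -> principal a (r * b).
Proof.
move=> maxN Na areg; have pN := maximal_ideal_prime maxN.
have [idN nN1 NM] := pN; have [P0 PD PZ] := principal_ideal a.
pose colon b : set R := [set r | principal a (r * b)].
have id_colon b : is_ideal (colon b).
  split; rewrite /colon /=; first by rewrite mul0r.
    by move=> x y ax ay; rewrite mulrDl; exact: PD.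
  by move=> c x ax; rewrite -mulrA; exact: PZ.
pose G J := exists2 b, J = colon b & J `<=` N.
have [_ [b -> _]||J [[b eJ JN] maxJ]] := maximal_ideal_in noethR (G := G).
- exact: id_colon.
- exists (colon 1), 1 => //; apply: subset_trans (principal_sub idN Na).
  by move=> r; rewrite /colon /= mulr1.
have Ja : J a by rewrite eJ /colon /=; exists b.
have pJ : prime_ideal J.
  split; first by rewrite eJ.
    by move=> J1; apply: nN1; exact: JN.
  move=> u v Juv; apply: contrapT => /not_orP[nJu nJv].
  have idJ : is_ideal J by rewrite eJ.
  have [_ _ JZ] := idJ.
  (* by maximality, multiplying b by an element outside N does not change its colon ideal *)
  have scaled s : ~ N s -> colon (s * b) = J.
    move=> nNs; apply: maxJ; last first.
      by move=> r; rewrite eJ /colon /= mulrCA => /PZ.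
    exists (s * b) => // r; rewrite /colon /= mulrA => rsb.
    have /JN/NM[] // : J (r * s) by rewrite eJ.
  have [s [ns Jsu]] : exists s, ~ N s /\ J (s * u).
    apply: contrapT => none; apply: nJv.
    have <- : colon (u * b) = J.
      apply: maxJ; last by move=> r; rewrite eJ /colon /= mulrCA => /PZ.
      exists (u * b) => // r; rewrite /colon /= mulrA => rub.
      by apply: contrapT => nNr; apply: none; exists r; split; rewrite ?eJ.
    by rewrite /colon /= mulrA [v * u]mulrC; move: Juv; rewrite {1}eJ.
  apply: nJu; rewrite -(scaled s ns) /colon /= mulrA [u * s]mulrC.
  by move: Jsu; rewrite {1}eJ.
have eN := regular_prime_maximal noethR no3R areg pJ Ja pN JN.
exists b; split; last by move=> r; rewrite -eN eJ.
by move=> ab; apply: nN1; rewrite -eN eJ /colon /= mul1r.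
Qed.

(** Choose [b] with [b N] in [a R] and [b] not in [a R]. If [b / a] mapped [N]
    into itself it would be almost integral, hence in [R]; so [(b / a) n = u] is
    outside [N] for some [n] in [N]. Let [al] be [1] modulo [N] and [0] modulo
    the other maximal ideals, and [de = 1 - al]. Then
    [pi = al n + de ^ 2] lies in [N], and its product with the fraction
    [al (b / a) + de ^ 2], which also maps [N] into [R], is a unit. *)
Lemma maximal_principal (N : set R) : maximal_ideal N -> exists pi, N = principal pi.
Proof.
move=> maxN; have [idN nN1 NM] := maximal_ideal_prime maxN; have [N0 ND NZ] := idN.
have [a Na areg] := regR maxN.
have [b [nab Nab]] := regular_colon_maximal maxN Na areg.
(* otherwise b / a would be almost integral *)
have [n [u [Nn nNu nbau]]] : exists n u, [/\ N n, ~ N u & n * b = a * u].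
  apply: contrapT => none.
  have next r : exists y, N r -> N y /\ a * y = b * r.
    have [Nr|nNr] := pselect (N r); last by exists 0.
    have [y _ ey] := Nab r Nr; exists y => _; split; last by rewrite ey mulrC.
    by apply: contrapT => nNy; apply: none; exists r, y.
  have [f fP] := choice next; pose x m := iter m f a.
  have Nx m : N (x m) by elim: m => //= m /fP[].
  by apply: nab; apply: (@closedR a b x) => // m; have [] := fP _ (Nx m).
have /finite_seqP[s es] := semiR.
have smax M : (M \in s) = maximal_ideal M :> Prop.
  by have : [set` s] M = maximal_ideal M by rewrite -es.
have [|al [sal Nal]] := @separate_maximals R N [seq M <- s | M != N] maxN.
  by move=> M; rewrite mem_filter => /andP[/eqP neM]; rewrite smax.
pose de := 1 - al; pose be := de * de; pose pi := n * al + be.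
have Npi : N pi by apply: ND; [rewrite mulrC; exact: NZ | exact: NZ].
have [v _ ev] := Nab de Nal.
pose w := al ^+ 2 * u + al * de * v + pi * be.
have ew : pi * (al * b + be * a) = a * w.
  transitivity (al ^+ 2 * (n * b) + al * de * (de * b) + a * (pi * be)).
    by rewrite /pi /be; ring.
  by rewrite nbau -ev /w; ring.
have [|w' ww'] := unit_of_maximals noethR (w := w).
  move=> M maxM Mw; have [idM nM1 MM] := maximal_ideal_prime maxM.
  have [_ MD MZ] := idM.
  have [eM|neM] := pselect (M = N).
    subst M.
    have Nu : N (al ^+ 2 * u).
      have -> : al ^+ 2 * u = w - (al * v) * de - be * pi by rewrite /w; ring.
      by apply: idealB => //; [apply: idealB => // |]; exact: NZ.
    have nNal : ~ N al by move=> Na'; apply: nN1; rewrite -(subrK al 1); exact: ND.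
    by case/NM: Nu => //; rewrite expr2 => /NM[].
  have Mal : M al by apply: sal; rewrite mem_filter; apply/andP; split; [exact/eqP | rewrite smax].
  have : M (be ^+ 2).
    have -> : be ^+ 2 = w - (al * u + de * v + n * be) * al by rewrite /w /pi; ring.
    by apply: idealB => //; exact: MZ.
  rewrite /be -expr2 -exprM => /(prime_exp (maximal_ideal_prime maxM)) Mde.
  by apply: nM1; rewrite -(subrK al 1); exact: MD.
exists pi; apply/seteqP; split; last exact: principal_sub.
move=> r Nr; have [y _ ey] := Nab r Nr; exists ((al * y + be * r) * w') => //.
apply: areg; transitivity (a * w * r * w'); last by rewrite -[RHS]mulr1 -ww'; ring.
rewrite -ew; transitivity (pi * w' * (al * (r * b) + be * a * r)); last by ring.
by rewrite -ey; ring.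
Qed.

(** As long as [x] and [y] lie in a common maximal ideal, divide both by its
    generator; this stops because the ideal [(x)] grows. *)
Lemma regular_bezout (x y : R) : GRing.lreg x ->
  exists g x' y' p q, [/\ x = g * x', y = g * y' & p * x' + q * y' = 1].
Proof.
move=> xreg; suff claim : forall J, is_ideal J -> forall x y : R, GRing.lreg x -> J = principal x ->
    exists g x' y' p q, [/\ x = g * x', y = g * y' & p * x' + q * y' = 1].
  by apply: (claim (principal x)) => //; exact: principal_ideal.
move=> {x y xreg}; apply: (ideal_induction noethR) => J idJ IH x y xreg eJ.
have [[z [b [[p _ <-] e]]]|n1] := pselect (ideal_adjoin (principal x) y 1).
  by exists 1, x, y, p, b; rewrite !mul1r e; split=> //; ring.
have [N maxN sN] := maximal_above noethR (ideal_adjoin_ideal y (principal_ideal x)) n1.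
have [pi eN] := maximal_principal maxN.
have [x1 _ ex] : principal pi x.
  by rewrite -eN; apply: sN; apply: sub_ideal_adjoin; exact: mem_principal.
have [y1 _ ey] : principal pi y.
  by rewrite -eN; apply: sN; apply: mem_ideal_adjoin; exact: principal_ideal.
have x1reg : GRing.lreg x1 by apply: (@lreg_factor _ _ pi); rewrite mulrC ex.
have [|||g [x' [y' [p [q [e1 e2 e3]]]]]] := IH (principal x1) _ _ _ x1 y1 x1reg (erefl _).
- exact: principal_ideal.
- rewrite eJ; apply: principal_sub; first exact: principal_ideal.
  by rewrite -ex mulrC; exists pi.
- move=> e; have : principal x x1 by rewrite -eJ -e; exact: mem_principal.
  move=> [z _ ez]; have [_ nN1 _] := maxN; apply: nN1; rewrite eN; exists z => //.
  by apply: x1reg; rewrite mulr1 -[RHS]ez -ex; ring.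
by exists (pi * g), x', y', p, q; rewrite -ex -ey e1 e2 !mulrA; split.
Qed.

End CompletelyIntegrallyClosed.

Section IntegralClosureRing.

Variable A : comNzRingType.
Hypotheses (noethA : noetherian A) (semiA : semilocal A) (cmA : locally_cm_dim1 A).
Hypothesis fgB : finitely_generated (integral_closure A).
Local Notation B := (integral_closure A).
Local Notation Q := (total_frac A).
Local Notation iota := (@to_closure A).

(** The [A]-modules spanned by [b], [b q], ..., [b q ^ n] form a chain that
    stabilizes; cancelling [b] in the resulting relation gives a monic equation
    of [q]. *)
Lemma almost_integral (b : B) (q : Q) : GRing.lreg b ->
  (forall m, exists x : B, closure_frac x = closure_frac b * q ^+ m) ->
  exists x : B, closure_frac x = q.
Proof.
move=> breg /choice[f fP]; apply: mem_closureP.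
pose F n : set B := [set y | exists c : nat -> A, y = \sum_(i < n.+1) c i *: f i].
have subF n : is_submodule (F n).
  split; first by exists (fun=> 0); rewrite big1 // => i _; rewrite scale0r.
    move=> _ _ [c ->] [d ->]; exists (fun i => c i + d i); rewrite -big_split.
    by apply: eq_bigr => i _; rewrite scalerDl.
  move=> a _ [c ->]; exists (fun i => a * c i); rewrite scaler_sumr.
  by apply: eq_bigr => i _; rewrite scalerA.
have FS n : F n `<=` F n.+1.
  move=> _ [c ->]; exists (fun i => if (i < n.+1)%N then c i else 0).
  rewrite [RHS]big_ord_recr /= ltnn scale0r addr0.
  by apply: eq_bigr => i _; rewrite ltn_ord.
have [n Fn] := submodules_stabilize (closure_submodules_fin_gen noethA fgB) subF FS.
have [c ec] : F n (f n.+1).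
  rewrite -Fn; exists (fun i => if i == n.+1 then 1 else 0).
  rewrite big_ord_recr /= eqxx scale1r big1 ?add0r // => i _.
  by rewrite ltn_eqF ?scale0r.
apply/integralOverE; exists n.+1, (fun i => - c i).
have [r br] := closure_lreg_unit breg.
have cancel (u v : Q) : closure_frac b * u = closure_frac b * v -> u = v.
  by move=> e; rewrite -[u]mul1r -[v]mul1r -br mulrAC e mulrAC.
apply: cancel; rewrite mulr0 mulrDr -fP ec rmorph_sum mulr_sumr -big_split big1 // => i _.
rewrite closure_scaleE rmorphM /= fP ?closure_frac_iota rmorphN /=; ring.
Qed.

Lemma closure_almost_integrally_closed : almost_integrally_closed B.
Proof.
move=> a b x areg x0 xS.
have [r ar] := closure_lreg_unit areg.
have [m|y ey] := @almost_integral a (closure_frac b * r) areg; last first.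
  exists y => //; apply: closure_frac_inj.
  by rewrite rmorphM /= ey mulrCA ar mulr1.
exists (x m); elim: m => [|m IH]; first by rewrite x0 expr0 mulr1.
rewrite exprS mulrCA -IH mulrAC -rmorphM -xS rmorphM /=.
by rewrite mulrAC ar mul1r.
Qed.

Lemma closure_noetherian : noetherian B.
Proof.
exact: (@intermediate_noetherian A B (@to_closure A) idfun (fun x y e => e) (fun=> erefl) noethA fgB).
Qed.

Lemma closure_no_three_primes : no_three_primes B.
Proof.
exact: (@intermediate_no_three_primes A B (@to_closure A) idfun (fun x y e => e) (fun=> erefl) noethA cmA).
Qed.

Lemma closure_semilocal : semilocal B.
Proof.
exact: (@intermediate_semilocal A B (@to_closure A) idfun (fun x y e => e) (fun=> erefl) noethA fgB semiA cmA).
Qed.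

Lemma closure_jacobson_regular :
  exists2 t, GRing.lreg t & forall N : set B, maximal_ideal N -> N (iota t).
Proof.
exact: (@intermediate_jacobson_regular A B (@to_closure A) idfun (fun x y e => e) (fun=> erefl) noethA semiA cmA).
Qed.

Lemma closure_bezout (x y : B) : GRing.lreg x ->
  exists g x' y' p q, [/\ x = g * x', y = g * y' & p * x' + q * y' = 1].
Proof.
apply: regular_bezout; [exact: closure_noetherian | exact: closure_no_three_primes |
  exact: closure_semilocal | | exact: closure_almost_integrally_closed].
move=> N maxN; have [t treg tN] := closure_jacobson_regular.
by exists (iota t); [exact: tN | exact: iota_lreg].
Qed.

End IntegralClosureRing.

(** * Splittings, balanced maps and integrality over an ideal *)

Section Splitting.

Variable R : comNzRingType.

Lemma comaximal_powers (x y p q : R) n : p * x + q * y = 1 ->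
  exists p' q', p' * x ^+ n + q' * y ^+ n = 1.
Proof.
have one_side (u v a b : R) m : a * u + b * v = 1 -> exists a' b', a' * u + b' * v ^+ m = 1.
  move=> e; elim: m => [|m [a' [b' e']]]; first by exists 0, 1; rewrite expr0; ring.
  exists (a' + b' * v ^+ m * a), (b' * b); rewrite -[RHS]e' -[b' * v ^+ m in RHS]mulr1 -e exprS.
  ring.
move=> e; have [p1 [q1 e1]] := one_side _ _ _ _ n e.
have [|q2 [p2 e2]] := one_side (y ^+ n) x q1 p1 n; first by rewrite addrC.
by exists p2, q2; rewrite addrC.
Qed.

(** Let [e] and [f] be the two terms of the sum [1]. Then [e f] is a multiple of
    [c], so [e] is idempotent modulo [c]: it is [0] at the maximal ideals that
    contain [x] and [1] at the others. At each of them exactly one of [x e] and [y f] is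
    a unit, so [x e + y f] is invertible. The existence of [e] is the
    splitting of the zero-dimensional ring [R / c] into the part where [x] is
    nilpotent and the part where it is invertible; both are then corrected by
    a relation between [x ^ n] and [y ^ n] in order to make [f] a multiple of
    [y ^ n]. *)
Lemma split_powers (x y p q c : R) : noetherian R -> no_three_primes R ->
  GRing.lreg c -> (forall M : set R, maximal_ideal M -> M c) -> p * x + q * y = 1 ->
  exists n h k, [/\ x ^+ n * h + y ^+ n * k = 1, principal c (x ^+ n * k)
    & exists w', (x * (x ^+ n * h) + y * (y ^+ n * k)) * w' = 1].
Proof.
move=> noethR n3 creg Mc epq.
have [P0 PD PZ] := principal_ideal c.
pose K : set R := [set b | exists n, principal c (x ^+ n * b)].
have idK : is_ideal K.
  split; first by exists 0%N; rewrite mulr0.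
    move=> a b [m ca] [n cb]; exists (m + n)%N.
    have -> : x ^+ (m + n) * (a + b) = x ^+ n * (x ^+ m * a) + x ^+ m * (x ^+ n * b).
      by rewrite exprD; ring.
    by apply: PD; exact: PZ.
  by move=> a b [n cb]; exists n; rewrite mulrCA; exact: PZ.
have [f0 [b [[n0 cf0] e0]]] : ideal_adjoin K x 1.
  apply: contrapT => n1.
  have [M maxM sM] := maximal_above noethR (ideal_adjoin_ideal x idK) n1.
  have pM := maximal_ideal_prime maxM; have [idM nM1 MM] := pM.
  pose T : set R := [set s * t | s in [set x ^+ n | n in setT] & t in ~` M].
  have mT : mult_set T by apply: mult_setM; [exact: powers_mult_set | exact: prime_compl_mult_set].
  have [|P [pP cP PT]] := prime_avoiding noethR (principal_ideal c) mT.
    move=> z cz [_ [n _ <-] [t nMt ez]]; apply: nMt; apply: sM; apply: sub_ideal_adjoin.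
    by exists n; rewrite ez.
  have PM : P `<=` M.
    move=> z Pz; apply: contrapT => nMz; apply: (PT z Pz).
    by exists 1; [exists 0%N | exists z => //; rewrite mul1r].
  have eP := regular_prime_maximal noethR n3 creg pP (cP _ (mem_principal c)) pM PM.
  apply: (PT x); first by rewrite eP; apply: sM; exact: mem_ideal_adjoin.
  by exists x; [exists 1%N | exists 1 => //; rewrite mulr1].
pose n := n0.+1; have [p' [q' e']] := comaximal_powers n epq.
have [m em] : exists m, 1 - (b * x) ^+ n = f0 * m.
  exists (\sum_(i < n) 1 ^+ (n.-1 - i) * (b * x) ^+ i).
  by rewrite -[X in X - _](expr1n _ n) subrXX; congr (_ * _); rewrite e0 addrK.
pose f1 := 1 - (b * x) ^+ n.
have cf1 : principal c (x ^+ n * f1).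
  have -> : x ^+ n * f1 = x * m * (x ^+ n0 * f0) by rewrite /f1 em /n exprS; ring.
  exact: PZ.
pose h := b ^+ n + f1 * p'; pose k := f1 * q'.
have e1 : x ^+ n * h + y ^+ n * k = 1.
  transitivity ((b * x) ^+ n + f1 * (p' * x ^+ n + q' * y ^+ n)).
    by rewrite /h /k exprMn; ring.
  by rewrite e' mulr1 /f1 addrC subrK.
have ck : principal c (x ^+ n * k) by rewrite /k mulrA [_ * q']mulrC; exact: PZ.
exists n, h, k; split=> //; apply: unit_of_maximals => // M maxM Mw.
have [idM nM1 MM] := maximal_ideal_prime maxM; have [_ MD MZ] := idM.
have nMxy : M x -> ~ M y.
  by move=> Mx My; apply: nM1; rewrite -epq; apply: MD; exact: MZ.
have Me : M x -> M (x ^+ n * h) by move=> Mx; rewrite /n exprS -mulrA mulrC; exact: MZ.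
have [_ _ cM] := principal_ideal c.
have Mxk : M (x ^+ n * k) by apply: (principal_sub idM (Mc M maxM)).
have [Mx|nMx] := pselect (M x).
  have : M (y * (y ^+ n * k)).
    rewrite -[_ * _](addKr (x * (x ^+ n * h))) addrC; apply: idealB => //; apply: MZ; exact: Me.
  case/MM; first exact: nMxy.
  by move=> Mf; apply: nM1; rewrite -e1; apply: MD => //; exact: Me.
have Mk : M k by case/MM: Mxk => // /(prime_exp (maximal_ideal_prime maxM)).
have Mf : M (y ^+ n * k) by exact: MZ.
have : M (x * (x ^+ n * h)).
  rewrite -[_ * _](addrK (y * (y ^+ n * k))); apply: idealB => //; exact: MZ.
by case/MM=> // Mh; apply: nM1; rewrite -e1; exact: MD.
Qed.

End Splitting.

Section Balanced.

Variables (R : comNzRingType) (T : zmodType) (F : R -> R -> T).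

Definition biadditive :=
  (forall u u' v, F (u + u') v = F u v + F u' v) /\
  (forall u v v', F u (v + v') = F u v + F u v').

Definition central (z : R) := forall u v, F (z * u) v = F u (z * v).

Hypothesis Fadd : biadditive.

(** As [x y' = y x'], both [x] and [y] allow to exchange [x'] on one side of
    [F] with [y'] on the other. With [e], [f] the two terms of the sum [1] and
    [z] one of [x], [y], this rewrites [F (z e) f] as [F] of [z (y' ^ n h)] and
    [x' ^ n k]; the latter is central, so the value depends only on the product
    [z e f]. The four cross terms of the two sides then cancel. *)
Lemma balanced_combination (x y g x' y' h k : R) n :
  central x -> central y -> x = g * x' -> y = g * y' ->
  x' ^+ n * h + y' ^+ n * k = 1 -> (forall b, central (x' ^+ n * k * b)) ->
  F (x * (x' ^+ n * h) + y * (y' ^+ n * k)) 1 = F 1 (x * (x' ^+ n * h) + y * (y' ^+ n * k)).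
Proof.
have [FD FDr] := Fadd.
move=> cx cy ex ey e1 cd; set e := x' ^+ n * h in e1 *; set f := y' ^+ n * k in e1 *.
have xy : x * y' = y * x' by rewrite ex ey; ring.
have swap z : z = x \/ z = y -> forall u v, F (z * (x' * u)) (y' * v) = F (z * (y' * u)) (x' * v).
  case=> -> u v.
    rewrite cx [x * (y' * v)]mulrA xy -mulrA -cy.
    by congr (F _ _); rewrite !mulrA xy.
  rewrite [y * (x' * u)]mulrA -xy -mulrA cx [x * (y' * v)]mulrA xy -mulrA -cy.
  by [].
have swapn z u v : z = x \/ z = y ->
    F (z * (x' ^+ n * u)) (y' ^+ n * v) = F (z * (y' ^+ n * u)) (x' ^+ n * v).
  move=> zxy; elim: n u v {e f e1 cd} => [|m IH] u v; first by rewrite !expr0.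
  rewrite ![_ ^+ m.+1]exprS -!mulrA (swap z zxy).
  rewrite [y' * (x' ^+ m * u)]mulrCA [x' * (y' ^+ m * v)]mulrCA IH.
  by congr (F _ _); [rewrite [y' ^+ m * _]mulrCA | rewrite [x' ^+ m * _]mulrCA].
have ef z : z = x \/ z = y -> F (z * e) f = F (z * f) e.
  move=> zxy; pose d := x' ^+ n * k; pose u := y' ^+ n * h.
  have cd1 : central d by move=> v v'; rewrite -[d]mulr1 cd.
  transitivity (F 1 (d * (z * u))).
    transitivity (F (d * (z * u) * 1) 1); first by rewrite mulr1 cd1 mulr1 /e /f swapn.
    by rewrite (cd (z * u)) mulr1.
  transitivity (F (d * z * 1) u); first by rewrite (cd z) -mulrA.
  by rewrite mulr1 [d * z]mulrC /d /u -swapn.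
have xe : x = x * e + x * f by rewrite -mulrDr e1 mulr1.
have ye : y = y * e + y * f by rewrite -mulrDr e1 mulr1.
have F1 z u : central z -> F 1 (z * u) = F z u by move=> cz; rewrite -cz mulr1.
have Rx : F 1 (x * e) = F (x * e) e + F (x * f) e by rewrite F1 // {1}xe FD.
have Ry : F 1 (y * f) = F (y * e) f + F (y * f) f by rewrite F1 // {1}ye FD.
have Lx : F (x * e) 1 = F (x * e) e + F (x * e) f by rewrite -FDr e1.
have Ly : F (y * f) 1 = F (y * f) e + F (y * f) f by rewrite -FDr e1.
by rewrite FD FDr Lx Ly Rx Ry (ef x) ?(ef y) //; [right | left].
Qed.

End Balanced.

Section IntegralOverIdeal.

Variables (R : comNzRingType) (I : set R) (z : R).
Hypothesis idI : is_ideal I.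

(** [v] is homogeneous of weight [n] when both [z] and the elements of [I] have
    weight one; integrality over [I] is [weighted n 1 0]. *)
Definition weighted n (c v : R) := exists b : nat -> R,
  [/\ b 0%N = c, forall j, ideal_exp I j (b j) & v = \sum_(j < n.+1) b j * z ^+ (n - j)].

Lemma ideal_exp_ideal n : is_ideal (ideal_exp I n).
Proof. by case: n => [|n]; [exact: setT_ideal | exact: ideal_span_ideal]. Qed.

Lemma weighted1 : weighted 0 1 1.
Proof.
exists (fun j => if j is 0%N then 1 else 0); split=> //.
  by case=> // j; have [] := ideal_exp_ideal j.+1.
by rewrite big_ord1 expr0 mulr1.
Qed.

Lemma weightedD n c d u v : weighted n c u -> weighted n d v -> weighted n (c + d) (u + v).
Proof.
move=> [a [a0 Ia ->]] [b [b0 Ib ->]]; exists (fun j => a j + b j); split.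
- by rewrite a0 b0.
- by move=> j; have [_ ID _] := ideal_exp_ideal j; exact: ID.
- by rewrite -big_split; apply: eq_bigr => j _; rewrite mulrDl.
Qed.

Lemma weightedZ n c v r : weighted n c v -> weighted n (r * c) (r * v).
Proof.
move=> [a [a0 Ia ->]]; exists (fun j => r * a j); split; first by rewrite a0.
  by move=> j; have [_ _ IZ] := ideal_exp_ideal j; exact: IZ.
by rewrite mulr_sumr; apply: eq_bigr => j _; rewrite mulrA.
Qed.

Lemma weightedX n c v : weighted n c v -> weighted n.+1 c (z * v).
Proof.
move=> [b [b0 Ib ->]]; exists (fun j => if (j < n.+1)%N then b j else 0); split=> //.
  by move=> j; case: ifP => // _; have [] := ideal_exp_ideal j.
rewrite [RHS]big_ord_recr /= ltnn mul0r addr0 mulr_sumr; apply: eq_bigr => j _.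
by rewrite ltn_ord mulrCA -exprS subSn // -ltnS.
Qed.

Lemma weighted_shift n c v d : I d -> weighted n c v -> weighted n.+1 0 (d * v).
Proof.
move=> Id [b [b0 Ib ->]]; exists (fun j => if j is j'.+1 then d * b j' else 0); split=> //.
  case=> // j; apply: sub_gen_smallest; exists d => //; exists (b j) => //; exact: Ib.
rewrite [RHS]big_ord_recl mul0r add0r mulr_sumr; apply: eq_bigr => j _.
by rewrite /= ?add1n subSS mulrA.
Qed.

Lemma weighted_shifts n c v d m : I d -> weighted n c v -> weighted (m.+1 + n) 0 (d ^+ m.+1 * v).
Proof.
move=> Id wv; elim: m => [|m IH]; first exact: weighted_shift wv.
rewrite exprS -mulrA; exact: weighted_shift IH.
Qed.

Lemma weighted_power p i : I p -> weighted i 1 ((z - p) ^+ i).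
Proof.
move=> Ip; elim: i => [|i IH]; first by rewrite expr0; exact: weighted1.
rewrite exprS mulrDl -[X in weighted _ X _]addr0; apply: weightedD; first exact: weightedX.
by apply: weighted_shift IH; exact: idealN.
Qed.

Lemma weighted_integral n : (0 < n)%N -> weighted n 1 0 -> integral_over_ideal I z.
Proof.
move=> n0 [b [b0 Ib e]]; exists n, b; split=> //.
rewrite [RHS]e big_ord_recl b0 mul1r subn0; congr (_ + _).
rewrite big_add1 /= big_mkord; apply: eq_bigr => i _.
by rewrite /= ?add1n.
Qed.

(** This is the equation of [z - p = d e] obtained by scaling that of an integral
    element [e] by a power of [d]. *)
Lemma integral_translate p d n (a : nat -> R) : I p -> I d -> (0 < n)%N ->
  (z - p) ^+ n + \sum_(i < n) a i * (d ^+ (n - i) * (z - p) ^+ i) = 0 ->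
  integral_over_ideal I z.
Proof.
move=> Ip Id n0 e; apply: (weighted_integral n0); rewrite -e -[X in weighted _ X _]addr0.
apply: weightedD; first exact: weighted_power.
elim/big_ind: _ => [|u v wu wv|i _].
- by have := weightedZ 0 (weighted_power n Ip); rewrite !mul0r.
- by rewrite -[0]addr0; exact: weightedD.
rewrite -[0](mulr0 (a i)); apply: weightedZ.
have := weighted_shifts (n - i).-1 Id (weighted_power i Ip).
by rewrite prednK ?subn_gt0 // subnK // ltnW.
Qed.

End IntegralOverIdeal.

(** * The strict closure is an Arf ring *)

(** Clearing the denominators of a monic equation of [q = y / x]. *)
Lemma homogenize (R : comPzRingType) (x q : R) n (c : nat -> R) :
  (x * q) ^+ n + \sum_(i < n) c i * (x ^+ (n - i) * (x * q) ^+ i) =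
  x ^+ n * (q ^+ n + \sum_(i < n) c i * q ^+ i).
Proof.
rewrite mulrDr exprMn mulr_sumr; congr (_ + _); apply: eq_bigr => i _.
have -> : x ^+ n = x ^+ (n - i) * x ^+ i by rewrite -exprD subnK // ltnW.
by rewrite exprMn; ring.
Qed.

Section Subrings.

Variables (R : comNzRingType) (E : subringClosed R).

(** A named copy of the inclusion, as for the integral closure in the ring of
    fractions. *)
Definition subring_incl (x : subring_type E) : R := subring_val x.

Lemma subring_incl_zmod_morphism : zmod_morphism subring_incl.
Proof. by []. Qed.

Lemma subring_incl_monoid_morphism : monoid_morphism subring_incl.
Proof. by []. Qed.

HB.instance Definition _ := GRing.isZmodMorphism.Build (subring_type E) R
  subring_incl subring_incl_zmod_morphism.
HB.instance Definition _ := GRing.isMonoidMorphism.Build (subring_type E) R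
  subring_incl subring_incl_monoid_morphism.

Lemma subring_incl_inj : injective subring_incl.
Proof. by move=> x y e; apply: val_inj. Qed.

Lemma subring_incl_mem x : subring_incl x \in E.
Proof. exact: (valP x). Qed.

Lemma subring_inclP y : y \in E -> exists x, subring_incl x = y.
Proof. by move=> Ey; exists (SubringElt Ey). Qed.

Variables (A : comNzRingType) (f : {rmorphism A -> R}).
Hypothesis fE : forall a, f a \in E.

Definition subring_corestrict (a : A) : subring_type E := SubringElt (fE a).

Lemma subring_corestrict_zmod_morphism : zmod_morphism subring_corestrict.
Proof. by move=> a b; apply: val_inj; rewrite /= rmorphB. Qed.

Lemma subring_corestrict_monoid_morphism : monoid_morphism subring_corestrict.
Proof. by split=> [|a b]; apply: val_inj; rewrite /= ?rmorph1 ?rmorphM. Qed.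

HB.instance Definition _ := GRing.isZmodMorphism.Build A (subring_type E)
  subring_corestrict subring_corestrict_zmod_morphism.
HB.instance Definition _ := GRing.isMonoidMorphism.Build A (subring_type E)
  subring_corestrict subring_corestrict_monoid_morphism.

End Subrings.

Section IntegralQuotients.

Variables (A S : comNzRingType) (phi : {rmorphism A -> S}).
Variable psi : {rmorphism S -> integral_closure A}.
Hypotheses (psi_inj : injective psi) (psi_phi : forall a, psi (phi a) = to_closure a).
Local Notation B := (integral_closure A).

Lemma to_frac_frac (x y : S) (xS : x \in nzd S) : to_frac x * (frac y xS : total_frac S) = to_frac y.
Proof. by rewrite /to_frac -to_loc_frac. Qed.

(** Transitivity of integrality. *)
Lemma integral_over_closure (q : total_frac A) n (b : nat -> B) :
  q ^+ n + \sum_(i < n) closure_frac (b i) * q ^+ i = 0 -> exists x : B, closure_frac x = q.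
Proof.
move=> e; apply: mem_closureP.
pose p : {poly total_frac A} := 'X^n + \poly_(i < n) closure_frac (b i).
apply: (@integral_root_monic _ _ _ q p).
- by rewrite monicE lead_coefDl ?lead_coefXn // size_polyXn ltnS size_poly.
- apply/rootP; rewrite /p hornerD hornerXn -[RHS]e; congr (_ + _).
  rewrite (@horner_coef_wide _ n) ?size_poly //.
  by apply: eq_bigr => i _; rewrite coef_poly ltn_ord.
apply/integral_poly => i; rewrite /p coefD coefXn coef_poly.
apply: integral_add; first exact: integral_nat.
case: ifP => _; first exact: closure_frac_integral.
exact: integral0.
Qed.

Lemma integral_quotientP (x y : S) (xS : x \in nzd S) :
  integralOver to_frac (frac y xS : total_frac S) <-> exists u, psi y = psi x * u.
Proof.
have xreg : GRing.lreg x by apply/asboolP.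
have [xi xxi] := closure_lreg_unit (lreg_closure psi_inj psi_phi xreg).
have [xj xxj] := to_frac_unit xreg.
split=> [/integralOverE[n [a e]]|[u eu]].
  have eS : y ^+ n + \sum_(i < n) a i * (x ^+ (n - i) * y ^+ i) = 0.
    apply: to_frac_inj; rewrite rmorph0 rmorphD rmorphXn rmorph_sum /=.
    under eq_bigr => i _ do rewrite !rmorphM !rmorphXn /=.
    have := homogenize (to_frac x) (frac y xS : total_frac S) n (fun i => to_frac (a i)).
    by rewrite to_frac_frac e mulr0.
  have [u eu] : exists u : B, closure_frac u = xi * closure_frac (psi y).
    apply: (@integral_over_closure _ n (fun i => psi (a i))).
    have cancel (q : total_frac A) : closure_frac (psi x) ^+ n * q = 0 -> q = 0.
      by move=> e0; rewrite -[LHS]mul1r -(expr1n _ n) -xxi exprMn mulrAC e0 mul0r.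
    apply: cancel; rewrite -(homogenize _ _ _ (fun i => closure_frac (psi (a i)))) mulrA xxi mul1r.
    transitivity (closure_frac (psi 0)); last by rewrite !rmorph0.
    rewrite -eS 2!rmorphD 2!rmorphXn 2!rmorph_sum.
    by congr (_ + _) => //; apply: eq_bigr => i _; rewrite !rmorphM !rmorphXn.
  exists u; apply: closure_frac_inj.
  by rewrite rmorphM /= eu mulrA xxi mul1r.
have [n [a e]] := closure_integral u; apply/integralOverE; exists n, (fun i => phi (a i)).
set q : total_frac S := frac y xS.
have cancel (r : total_frac S) : to_frac x ^+ n * r = 0 -> r = 0.
  by move=> e0; rewrite -[LHS]mul1r -(expr1n _ n) -xxj exprMn mulrAC e0 mul0r.
apply: cancel; rewrite -(homogenize _ _ _ (fun i => to_frac (phi (a i)))) to_frac_frac.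
transitivity (to_frac (y ^+ n +
    \sum_(i < n) phi (a i) * (x ^+ (n - i) * y ^+ i))).
  rewrite rmorphD rmorphXn rmorph_sum; congr (_ + _); apply: eq_bigr => i _.
  by rewrite !rmorphM !rmorphXn.
transitivity (to_frac (0 : S)); last by rewrite rmorph0.
congr to_frac; apply: psi_inj; rewrite rmorph0 rmorphD rmorphXn rmorph_sum.
under eq_bigr => i _ do rewrite !rmorphM !rmorphXn psi_phi /=.
by rewrite eu (homogenize (psi x) u n (fun i => to_closure (a i))) e mulr0.
Qed.

Lemma integral_of_translate (I : set S) (z p d : S) (e : B) : is_ideal I -> I p -> I d ->
  psi z = psi p + psi d * e -> integral_over_ideal I z.
Proof.
move=> idI Ip Id ez; have [n [a ea]] := closure_integral e.
have n0 : (0 < n)%N.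
  case: n ea => // /eqP; rewrite big_ord0 addr0 expr0 oner_eq0 //.
apply: (integral_translate idI Ip Id n0 (a := fun i => phi (a i))).
apply: psi_inj; rewrite rmorph0 rmorphD rmorphXn rmorph_sum.
under eq_bigr => i _ do rewrite !rmorphM !rmorphXn psi_phi rmorphB /=.
rewrite rmorphB ez addrAC subrr add0r.
by rewrite (homogenize (psi d) e n (fun i => to_closure (a i))) ea mulr0.
Qed.

End IntegralQuotients.

Section StrictClosureArf.

Variable A : comNzRingType.
Hypotheses (noethA : noetherian A) (semiA : semilocal A) (cmA : locally_cm_dim1 A).
Hypothesis fgB : finitely_generated (integral_closure A).
Local Notation B := (integral_closure A).
Local Notation iota := (@to_closure A).
Local Notation C := (strict_closure A).
Local Notation tens := (@tmul A B B).

Lemma tens_biadditive : biadditive tens.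
Proof. by split=> *; [exact: tmulDl | exact: tmulDr]. Qed.

Lemma strict_closureE (x : B) : x \in C <-> tens x 1 = tens 1 x.
Proof. by split; [move=> /eqP | move=> e; apply/eqP]. Qed.

(** The map [s (x) t |-> s u (x) t v] is well defined, and it is applied to
    [x (x) 1 = 1 (x) x]. *)
Lemma strict_closure_central (x : B) : x \in C -> central tens x.
Proof.
move=> /strict_closureE e u v.
have [|||G GE] := @tensor_lift A B B _ (fun s t => tens (s * u) (t * v)).
- by move=> s s' t; rewrite mulrDl tmulDl.
- by move=> s t t'; rewrite mulrDl tmulDr.
- by move=> a s t; rewrite !closure_scaleE -!mulrA -closure_scaleE tmulZ.
by have := congr1 G e; rewrite !GE !mul1r.
Qed.

Lemma iota_strict (a : A) : iota a \in C.
Proof.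
have e : a *: (1 : B) = iota a by rewrite closure_scaleE mulr1.
by apply/strict_closureE; rewrite -e tmulZ.
Qed.

Lemma conductor_element : exists2 c : A, GRing.lreg c & forall b : B, exists a, iota c * b = iota a.
Proof.
have common (l : seq B) : exists2 c : A, GRing.lreg c &
    forall b, b \in l -> exists a, iota c * b = iota a.
  elim: l => [|b l [c creg IH]]; first by exists 1 => //; exact: lreg1.
  have [s [a [sreg e]]] := closureP b; exists (c * s); first exact: lregM.
  move=> b'; rewrite inE rmorphM => /predU1P[->|/IH[a' e']].
    by exists (c * a); rewrite -mulrA e rmorphM.
  by exists (s * a'); rewrite mulrAC e' mulrC rmorphM.
have [n [e eP]] := fgB; have [c creg ce] := common [seq e i | i <- enum 'I_n].
exists c => // b; have [k ->] := eP b.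
have /choice[a ea] i : exists a, iota c * e i = iota a by apply: ce; rewrite map_f ?mem_enum.
exists (\sum_i k i * a i); rewrite rmorph_sum mulr_sumr; apply: eq_bigr => i _.
by rewrite closure_scaleE mulrCA ea rmorphM.
Qed.

(** Over an infinite residue field a general linear combination of [x] and [y]
    would do. In general take [w = x e + y f] where [e + f = 1] and, modulo a
    conductor, [e] is the idempotent that is [1] at the maximal ideals where the
    valuation of [x] is at most that of [y], and [0] at the others. *)
Lemma strict_closure_gcd (x y : B) : x \in C -> y \in C -> GRing.lreg x ->
  exists e u v, let w := y + (x - y) * e in [/\ w \in C, x = w * u & y = w * v].
Proof.
move=> Cx Cy xreg.
have [g [x' [y' [p [q [ex ey epq]]]]]] := closure_bezout noethA semiA cmA fgB y xreg.
have [c0 c0reg cB] := conductor_element.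
have [t treg tN] := closure_jacobson_regular noethA semiA cmA.
have noethB := closure_noetherian noethA fgB.
have n3B := closure_no_three_primes noethA cmA.
have creg : GRing.lreg (iota (c0 * t)) by apply: iota_lreg; exact: lregM.
have cN (N : set B) : maximal_ideal N -> N (iota (c0 * t)).
  by move=> maxN; have [[_ _ NZ] _ _] := maxN; rewrite rmorphM; apply: NZ; exact: tN.
have [n [h [k [e1 [z _ ck] [w' ew']]]]] := split_powers noethB n3B creg cN epq.
exists (x' ^+ n * h).
set e := x' ^+ n * h; set f := y' ^+ n * k in e1 ew'.
have ef : f = 1 - e by rewrite -e1 addrAC subrr add0r.
have ew : y + (x - y) * e = x * e + y * f by rewrite ef mulrBl mulrBr mulr1 addrCA addrA addrC.
have ewg : y + (x - y) * e = g * (x' * e + y' * f) by rewrite ew {1}ex {1}ey -!mulrA -mulrDr.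
exists (w' * x'), (w' * y'); split.
- rewrite ew; apply/strict_closureE.
  apply: (balanced_combination tens_biadditive _ _ ex ey e1); try exact: strict_closure_central.
  move=> b; apply: strict_closure_central; rewrite -ck rmorphM -!mulrA.
  by have [a ->] := cB (iota t * (z * b)); exact: iota_strict.
- by rewrite ewg -mulrA [_ * (w' * x')]mulrA ew' mul1r -ex.
- by rewrite ewg -mulrA [_ * (w' * y')]mulrA ew' mul1r -ey.
Qed.

(** [x u v (x) 1 = v (x) y = v (x) x u = x v (x) u = z (x) u = 1 (x) z u]. *)
Lemma strict_closure_quotient (x y z : B) (u v : B) : x \in C -> y \in C -> z \in C ->
  y = x * u -> z = x * v -> x * (u * v) \in C.
Proof.
move=> /strict_closure_central cx /strict_closure_central cy /strict_closure_central cz eu ev.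
apply/strict_closureE; rewrite mulrA -eu cy mulr1 eu -cx -ev -[z in LHS]mulr1 cz.
by rewrite ev mulrAC.
Qed.

Local Notation S := (subring_type C).
Local Notation phi := (@subring_corestrict _ C _ iota iota_strict).
Local Notation psi := (@subring_incl _ C).

(** By [strict_closure_gcd] and induction on generators, [I] has an element [w] of
    which all elements of [I] are multiples in the integral closure. For [y], [z]
    in [I], the element [y z / w] is then strictly closed, and integral over
    [I], so it is in [I]; thus [I ^ 2 = w I]. *)
Lemma strict_closure_principal_reduction (I : set S) : integrally_closed_ideal I ->
  (exists x, I x /\ x \in nzd S) -> has_principal_reduction I.
Proof.
move=> [idI Icl] [x0 [Ix0 /asboolP x0reg]]; have [I0 ID IZ] := idI.
have transl (z p d : S) (e : B) : I p -> I d -> psi z = psi p + psi d * e -> I z.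
  move=> Ip Id ez; apply: Icl.
  exact: (@integral_of_translate A S phi psi (@subring_incl_inj _ _) (fun=> erefl) I z p d e).
have noethS : noetherian S.
  exact: (@intermediate_noetherian A S phi psi (@subring_incl_inj _ _) (fun=> erefl)).
have x0reg' : GRing.lreg (psi x0).
  exact: (@lreg_closure A S phi psi (@subring_incl_inj _ _) (fun=> erefl)).
have [l el] := noethS I idI.
have [w [Iw wreg lw]] : exists w, [/\ I w, GRing.lreg (psi w) &
    forall z, z \in l -> exists u, psi z = psi w * u].
  have : forall z, z \in l -> I z by move=> z lz; rewrite el; apply: sub_gen_smallest.
  elim: l {el} => [_|y l IH lI]; first by exists x0.
  have [|w [Iw wreg lw]] := IH; first by move=> z lz; apply: lI; rewrite inE lz orbT.
  have Iy : I y by apply: lI; rewrite mem_head.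
  have [e [u [v [Cw eu ev]]]] := strict_closure_gcd (subring_incl_mem w) (subring_incl_mem y) wreg.
  have [w1 ew1] := subring_inclP Cw.
  rewrite -ew1 in eu ev; exists w1; split.
  - by apply: (transl w1 y (w - y) e) => //; exact: idealB.
  - by apply: (@lreg_factor _ _ u); rewrite -eu.
  move=> z; rewrite inE => /predU1P[->|/lw[u' ->]]; first by exists v.
  by exists (u * u'); rewrite mulrA -eu.
have Iw_all z : I z -> exists u, psi z = psi w * u.
  rewrite el; move: z; apply: (@smallest_sub _ (@is_ideal S) _ [set z | exists u, psi z = psi w * u]).
    split; first by exists 0; rewrite rmorph0 mulr0.
      by move=> y z [u eu] [v ev]; exists (u + v); rewrite rmorphD /= eu ev mulrDr.
    by move=> a z [u eu]; exists (psi a * u); rewrite rmorphM /= eu mulrCA.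
  by move=> z /= /lw.
have mulI y z : I y -> I z -> exists2 b, I b & y * z = w * b.
  move=> Iy Iz; have [u eu] := Iw_all y Iy; have [v ev] := Iw_all z Iz.
  have Cb := strict_closure_quotient (subring_incl_mem w) (subring_incl_mem y)
    (subring_incl_mem z) eu ev.
  have [b eb] := subring_inclP Cb; exists b.
    by apply: (transl b 0 w (u * v)) => //; rewrite eb rmorph0 add0r.
  by apply: subring_incl_inj; rewrite !rmorphM /= eb eu ev mulrACA -mulrA.
have exp1 : ideal_exp I 1 = I.
  apply/seteqP; split.
    by apply: smallest_sub => // _ [a Ia [b _ <-]]; rewrite mulrC; exact: IZ.
  by move=> a Ia; apply: sub_gen_smallest; exists a => //; exists 1 => //; rewrite mulr1.
exists 1%N, w; split=> //.
rewrite [ideal_exp I 2]/(ideal_mul I (ideal_exp I 1)) exp1; apply/seteqP; split; last first.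
  by move=> _ [b Ib <-]; apply: sub_gen_smallest; exists w => //; exists b.
apply: smallest_sub.
  split; first by exists 0; rewrite ?mulr0.
    by move=> _ _ [a Ia <-] [b Ib <-]; exists (a + b); [exact: ID | rewrite mulrDr].
  by move=> r _ [a Ia <-]; exists (r * a); [exact: IZ | rewrite mulrCA].
by move=> _ [y Iy [z Iz <-]]; have [b Ib ->] := mulI y z Iy Iz; exists b.
Qed.

Lemma strict_closure_arf : is_arf S.
Proof.
have inj := @subring_incl_inj _ C; have id : forall a, psi (phi a) = iota a by [].
split.
- exact: (intermediate_noetherian inj id noethA fgB).
- exact: (intermediate_semilocal inj id noethA fgB semiA cmA).
- exact: (intermediate_cm_dim1 inj id noethA fgB semiA cmA).
- exact: strict_closure_principal_reduction.
move=> x y z xS /(integral_quotientP inj id)[u eu] /(integral_quotientP inj id)[v ev].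
have [b eb] := subring_inclP (strict_closure_quotient (subring_incl_mem x)
  (subring_incl_mem y) (subring_incl_mem z) eu ev).
exists b; apply: frac_congr; apply: inj.
by rewrite mulr1 !rmorphM /= eb eu ev mulrACA [RHS]mulrAC.
Qed.

End StrictClosureArf.

(** * Separating tensors over a subring *)

Section QuotientGroups.

Variables (Z : zmodType) (H : set Z).

Definition subgroup_pred of is_subgroup H : {pred Z} := [pred z | `[< H z >]].

Variable subH : is_subgroup H.

Lemma subgroup_zmod_closed : zmod_closed (subgroup_pred subH).
Proof.
have [H0 HB] := subH; split=> [|x y /asboolP Hx /asboolP Hy]; apply/asboolP => //.
exact: HB.
Qed.

HB.instance Definition _ := GRing.isZmodClosed.Build Z (subgroup_pred subH)
  subgroup_zmod_closed.

Lemma quotient_group : exists (T : zmodType) (p : {additive Z -> T}),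
  forall z, p z = 0 <-> H z.
Proof.
pose T : zmodType := Quotient.quot (subgroup_pred subH).
have piP (x y : Z) : \pi_T x = \pi_T y <-> H (x - y).
  split=> [e|Hxy].
    have : (x - y) \in subgroup_pred subH by rewrite Quotient.idealrBE; apply/eqP.
    by move/asboolP.
  by apply/eqP; rewrite -Quotient.idealrBE; apply/asboolP.
pose p (z : Z) : T := \pi_T z.
have pB : zmod_morphism p by exact: (raddfB (\pi_T)).
pose p' : {additive Z -> T} := HB.pack p (GRing.isZmodMorphism.Build Z T p pB).
exists T, p' => z; rewrite -(raddf0 p') -[H z]/(H z) -[z in H z]subr0.
exact: (piP z 0).
Qed.

End QuotientGroups.

Section Separation.

Variables (R : comNzRingType) (E : set R).

Definition is_subring := E 1 /\ forall x y, E x -> E y -> E (x - y) /\ E (x * y).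

Definition is_module (L : set R) :=
  [/\ L 0, forall x y, L x -> L y -> L (x + y) & forall e x, E e -> L x -> L (e * x)].

(** By the universal property, this is [x (x) 1 = 1 (x) x] in the tensor square of
    [R] over [E]; the balanced maps make it easy to vary [E]. *)
Definition strictly_closed_over (x : R) := forall (T : zmodType) (F : R -> R -> T),
  biadditive F -> (forall e, E e -> central F e) -> F x 1 = F 1 x.

Hypothesis subE : is_subring.

Lemma subring0 : E 0.
Proof. by have [E1 Ec] := subE; rewrite -(subrr 1); have [] := Ec 1 1 E1 E1. Qed.

Lemma subringB x y : E x -> E y -> E (x - y).
Proof. by have [E1 Ec] := subE => Ex Ey; have [] := Ec x y Ex Ey. Qed.

Lemma subringM x y : E x -> E y -> E (x * y).
Proof. by have [E1 Ec] := subE => Ex Ey; have [] := Ec x y Ex Ey. Qed.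

Lemma subringN x : E x -> E (- x).
Proof. by move=> Ex; rewrite -sub0r; apply: subringB => //; exact: subring0. Qed.

Lemma subringD x y : E x -> E y -> E (x + y).
Proof. by move=> Ex Ey; rewrite -[y]opprK; apply: subringB => //; exact: subringN. Qed.

Lemma moduleN L x : is_module L -> L x -> L (- x).
Proof.
by move=> [_ _ LE] Lx; rewrite -mulN1r; apply: LE => //; apply: subringN; have [] := subE.
Qed.

Lemma moduleB L x y : is_module L -> L x -> L y -> L (x - y).
Proof. by move=> mL Lx Ly; have [_ LD _] := mL; apply: LD => //; exact: moduleN. Qed.

Definition module_adjoin (L : set R) (e : R) : set R :=
  [set u | exists l r, [/\ L l, E r & u = l + r * e]].

Lemma module_adjoin_module L e : is_module L -> is_module (module_adjoin L e).
Proof.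
case=> L0 LD LE; split.
- by exists 0, 0; split=> //; [exact: subring0 | ring].
- move=> _ _ [l [r [Ll Er ->]]] [l' [r' [Ll' Er' ->]]]; exists (l + l'), (r + r').
  by split; [exact: LD | exact: subringD | ring].
- move=> c _ Ec [l [r [Ll Er ->]]]; exists (c * l), (c * r).
  by split; [exact: LE | exact: subringM | ring].
Qed.

Lemma sub_module_adjoin L e : L `<=` module_adjoin L e.
Proof. by move=> l Ll; exists l, 0; split=> //; [exact: subring0 | ring]. Qed.

Lemma mem_module_adjoin L e : is_module L -> module_adjoin L e e.
Proof. by case=> L0 _ _; exists 0, 1; split=> //; [have [] := subE | ring]. Qed.

Hypothesis maximal_module : forall G : set R -> Prop,
  (forall L, G L -> is_module L) -> (exists L, G L) ->
  exists L, G L /\ forall L', G L' -> L `<=` L' -> L' = L.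

(** The multiples of [a] cut out a maximal ideal of [E]. *)
Variable a : R.
Hypotheses (Ea : E a) (areg : GRing.lreg a) (nunit : ~ principal a 1).
Hypothesis residue_field : forall d, E d -> ~ principal a d ->
  exists2 e, E e & principal a (1 - e * d).

Lemma principal_module : is_module (principal a).
Proof. by have [P0 PD PZ] := principal_ideal a; split=> // e x _; exact: PZ. Qed.

(** The residue field [k] of [E] at [a] acts on [R / a R]. A [k]-linear form [la]
    on it with [la 1 = 1] yields the [E]-bilinear map [u, v |-> la u * v] to
    [R / a R], which sends [x (x) 1] to [la x] and [1 (x) x] to [x]. The
    kernel of [la] is a maximal [E]-submodule [L] over [a R] that does not
    contain [1]. *)
Lemma strictly_closed_residue x : strictly_closed_over x ->
  exists v y, E v /\ x = v + a * y.
Proof.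
move=> xstrict; have [E1 _] := subE.
pose G L := [/\ is_module L, principal a `<=` L & ~ L 1].
have [L []||L [[mL aL nL1] maxL]] := maximal_module (G := G) => //.
  by exists (principal a); split=> //; exact: principal_module.
have [L0 LD LE] := mL.
have LEa d : E d -> L d -> principal a d.
  move=> Ed Ld; apply: contrapT => nad; have [e Ee ae] := residue_field Ed nad.
  by apply: nL1; rewrite -[1](subrK (e * d)); apply: LD; [exact: aL | exact: LE].
(* L is a hyperplane: every u is congruent to an element of E modulo L *)
have hyper u : exists l, E l /\ L (u - l).
  have [Lu|nLu] := pselect (L u); first by exists 0; split; [exact: subring0 | rewrite subr0].
  have : module_adjoin L u 1.
    apply: contrapT => n1; apply: nLu; rewrite -(maxL (module_adjoin L u)).
    - exact: mem_module_adjoin.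
    - split=> //; first exact: module_adjoin_module.
      by apply: subset_trans aL _; exact: sub_module_adjoin.
    - exact: sub_module_adjoin.
  move=> [l [r [Ll Er e1]]].
  have nar : ~ principal a r.
    move=> [w _ er]; apply: nL1; rewrite e1; apply: LD => //; apply: aL.
    by exists (w * u); rewrite // mulrA er.
  have [e Ee [w _ ew]] := residue_field Er nar.
  exists e; split=> //.
  have -> : u - e = a * (w * u) - e * l.
    have ru : r * u = 1 - l by rewrite e1 addrAC subrr add0r.
    by rewrite mulrA ew; transitivity (u - e * (r * u) - e * l); [rewrite ru; ring | ring].
  by apply: moduleB => //; [apply: aL; exists (w * u) | exact: LE].
have [la laP] := choice hyper.
have subP : is_subgroup (principal a).
  have idP := principal_ideal a; split; first by have [] := idP.
  by move=> u v; exact: idealB.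
have [T [p pP]] := quotient_group subP.
have pE u v : principal a (u - v) -> p u = p v.
  by move=> auv; apply/eqP; rewrite -subr_eq0 -raddfB; apply/eqP/pP.
have mult_a v d : principal a d -> principal a (d * v).
  by move=> [w _ <-]; exists (w * v); rewrite ?mulrA.
pose F u v := p (la u * v).
have Fadd : biadditive F.
  split=> [u u' v|u v v']; last by rewrite /F mulrDr raddfD.
  rewrite /F -raddfD; apply: pE; rewrite -mulrDl -mulrBl; apply: mult_a; apply: LEa.
    by apply: subringB; [|apply: subringD]; apply (laP _).1.
  have -> : la (u + u') - (la u + la u') = (u - la u) + (u' - la u') - (u + u' - la (u + u')).
    by ring.
  by apply: moduleB => //; [apply: LD|]; apply (laP _).2.
have Fbal e : E e -> central F e.
  move=> Ee u v; rewrite /F; apply: pE; rewrite mulrCA mulrA -mulrBl; apply: mult_a; apply: LEa.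
    by apply: subringB; [|apply: subringM => //]; apply (laP _).1.
  have -> : la (e * u) - e * la u = e * (u - la u) - (e * u - la (e * u)) by ring.
  by apply: moduleB => //; [apply: LE => //|]; apply (laP _).2.
have := xstrict T F Fadd Fbal; rewrite /F mulr1 => /eqP; rewrite -subr_eq0 -raddfB => /eqP/pP.
move=> [w _ ew].
have [w' _ ew'] : principal a (1 - la 1).
  by apply: LEa; [apply: subringB => //; apply (laP _).1 | apply (laP _).2].
exists (la x), (w' * x - w); split; first by apply (laP _).1.
by rewrite mulrBr ew mulrA ew'; ring.
Qed.

(** The map [u (x) v |-> a u (x) v] from the tensor square over
    [{u | a u \in E}] to the one over [E] is injective: a bilinear map on
    the former, transported to [a R x R], extends to [R x R]. The extension is
    built by adjoining one generator [e] of the first factor at a time; the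
    only obstruction is that [a e] already lies in the domain, and the
    enlargement of the target removes it. *)
Lemma strictly_closed_divide y : strictly_closed_over (a * y) ->
  forall (T : zmodType) (F : R -> R -> T), biadditive F ->
    (forall c, E (a * c) -> central F c) -> F y 1 = F 1 y.
Proof.
move=> aystrict T F [FD FDr] Fbal.
pose extends (L : set R) (T' : zmodType) (j : {additive T -> T'}) (g : R -> R -> T') :=
  [/\ injective j, forall u u' v, L u -> L u' -> g (u + u') v = g u v + g u' v,
      forall u v v', L u -> g u (v + v') = g u v + g u v',
      forall e u v, E e -> L u -> g (e * u) v = g u (e * v)
    & forall w v, g (a * w) v = j (F w v)].
pose G L := [/\ is_module L, principal a `<=` L & exists T' j g, @extends L T' j g].
have [L []||L [[mL aL [T' [j [g [jinj gD gDr gE ga]]]]] maxL]] := maximal_module (G := G) => //.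
  exists (principal a); split=> //; first exact: principal_module.
  have /choice[q qP] u : exists w, principal a u -> a * w = u.
    by have [[w _ <-]|nu] := pselect (principal a u); [exists w | exists 0].
  have qa w : q (a * w) = w by apply: areg; apply: qP; exists w.
  exists T, idfun, (fun u v => F (q u) v); split=> //.
  - by move=> _ _ v [u _ <-] [u' _ <-]; rewrite -mulrDr !qa FD.
  - move=> e _ v Ee [u _ <-]; rewrite mulrCA !qa Fbal //.
    exact: subringM.
  - by move=> w v; rewrite qa.
have [L0 LD LE] := mL.
suff Ltop u : L u.
  apply: jinj; rewrite -!ga.
  have -> : g (a * 1) y = g 1 (a * y) by rewrite gE.
  apply: (aystrict T' g); first by split=> *; [exact: gD | exact: gDr].
  by move=> e Ee v v'; exact: gE.
apply: contrapT => nLu.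
have big : module_adjoin L u <> L.
  by move=> e; apply: nLu; rewrite -e; exact: mem_module_adjoin.
apply: big; apply: maxL; last exact: sub_module_adjoin.
split; first exact: module_adjoin_module.
  by apply: subset_trans aL _; exact: sub_module_adjoin.
have Fv0 w : F w 0 = 0 by apply: (addIr (F w 0)); rewrite -FDr !add0r.
have FNr w v : F w (- v) = - F w v.
  by apply/eqP; rewrite -addr_eq0 -FDr addNr Fv0.
have FB w v v' : F w (v - v') = F w v - F w v' by rewrite FDr FNr.
pose H : set (T' * R)%type := [set z | exists v, z = (j (F u v), - (a * v))].
have subH : is_subgroup H.
  split; first by exists 0; rewrite Fv0 raddf0 mulr0 oppr0.
  move=> _ _ [v ->] [v' ->]; exists (v - v').
  rewrite [LHS]surjective_pairing; congr (_, _) => /=; last by ring.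
  by rewrite FB raddfB.
have [T'' [p pP]] := quotient_group subH.
have pE z z' : H (z' - z) -> p z = p z'.
  by move=> Hz; apply/eqP; rewrite eq_sym -subr_eq0 -raddfB; apply/eqP/pP.
have wd l r l' r' v : L l -> L l' -> E r -> E r' -> l + r * u = l' + r' * u ->
    p (g l v, r * v) = p (g l' v, r' * v).
  move=> Ll Ll' Er Er' e.
  have el : l' - l = (r - r') * u.
    have -> : l' - l = (l' + r' * u) - l - r' * u by ring.
    by rewrite -e; ring.
  have [c _ ec] : principal a (r - r').
    apply: contrapT => nar; have [e0 Ee0 [w _ ew]] := residue_field (subringB Er Er') nar.
    apply: nLu; have -> : u = a * (w * u) + e0 * (l' - l) by rewrite el [a * _]mulrA ew; ring.
    by apply: LD; [apply: aL; exists (w * u) | apply: LE => //; exact: moduleB].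
  have Eac : E (a * c) by rewrite ec; exact: subringB.
  apply: pE; exists (c * v).
  have gl : g l' v = g l v + j (F u (c * v)).
    rewrite -Fbal // -ga mulrA ec -el -gD ?[l + _]addrC ?subrK //.
    exact: moduleB.
  by rewrite [LHS]surjective_pairing; congr (_, _); [rewrite /= gl /= addrAC subrr add0r | rewrite /= mulrA ec; ring].
have /choice[dec decP] z : exists lr : R * R, module_adjoin L u z ->
    [/\ L lr.1, E lr.2 & z = lr.1 + lr.2 * u].
  have [[l [r lrP]]|nz] := pselect (module_adjoin L u z); first by exists (l, r).
  by exists (0, 0).
pose h z v := p (g (dec z).1 v, (dec z).2 * v).
have hE l r v : L l -> E r -> h (l + r * u) v = p (g l v, r * v).
  move=> Ll Er; have [|Ld Ed ed] := decP (l + r * u); first by exists l, r.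
  by apply: wd.
pose i t := p (j t, 0).
have iB : zmod_morphism i.
  move=> s t; transitivity (p ((j s, 0) - (j t, 0))); last by rewrite raddfB.
  by rewrite /i [(j s, 0) - _]surjective_pairing /= subr0 raddfB.
pose i' : {additive T -> T''} := HB.pack i (GRing.isZmodMorphism.Build T T'' i iB).
exists T'', i', h; split.
- move=> s t; rewrite /= /i => /eqP; rewrite -subr_eq0 -raddfB => /eqP/pP[v [ej ev]].
  have v0 : v = 0 by apply: areg; apply: oppr_inj; rewrite -ev subrr mulr0 oppr0.
  by apply: jinj; apply/eqP; rewrite -subr_eq0; apply/eqP; rewrite [LHS]ej v0 Fv0 raddf0.
- move=> _ _ v [l [r [Ll Er ->]]] [l' [r' [Ll' Er' ->]]].
  have -> : l + r * u + (l' + r' * u) = (l + l') + (r + r') * u by ring.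
  rewrite !hE //; [|exact: LD|exact: subringD].
  by rewrite -raddfD gD // mulrDl.
- move=> _ v v' [l [r [Ll Er ->]]]; rewrite !hE // -raddfD gDr // mulrDr.
  by [].
- move=> e _ v Ee [l [r [Ll Er ->]]].
  have -> : e * (l + r * u) = e * l + (e * r) * u by ring.
  rewrite !hE //; [|exact: LE|exact: subringM].
  by rewrite gE // -mulrA mulrCA.
- move=> w v; have -> : a * w = a * w + 0 * u by ring.
  rewrite hE; [|by apply: aL; exists w|exact: subring0].
  by rewrite ga mul0r.
Qed.

End Separation.

(** * Arf rings between [A] and its integral closure *)

Section ArfIntermediate.

Variable A : comNzRingType.
Hypotheses (noethA : noetherian A) (fgB : finitely_generated (integral_closure A)).
Local Notation B := (integral_closure A).
Local Notation iota := (@to_closure A).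

Variable D : subringClosed (integral_closure A).
Hypothesis arfD : arf_between D.

Let iotaD : forall a, iota a \in D. Proof. by case: arfD. Qed.

Local Notation S := (subring_type D).
Local Notation phi := (@subring_corestrict _ D _ iota iotaD).
Local Notation psi := (@subring_incl _ D).

Let psi_inj : injective psi := @subring_incl_inj _ D.
Let psi_phi a : psi (phi a) = iota a := erefl.

(** The second Arf condition, read in the integral closure. *)
Lemma arf_quotient (b u v : B) : GRing.lreg b -> b \in D -> b * u \in D -> b * v \in D ->
  b * (u * v) \in D.
Proof.
move=> breg /subring_inclP[x ex] /subring_inclP[y ey] /subring_inclP[z ez].
have [_ [_ _ _ _ mulD]] := arfD.
have xreg : GRing.lreg x by apply: (closure_lreg_intermediate psi_inj); rewrite /= ex.
have xS : x \in nzd S by apply/asboolP.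
have [||d ed] := mulD x y z xS.
- by apply/(integral_quotientP psi_inj psi_phi); exists u; rewrite /= ey ex.
- by apply/(integral_quotientP psi_inj psi_phi); exists v; rewrite /= ez ex.
have exd : y * z = x * d.
  by apply: to_frac_inj; rewrite [RHS]rmorphM /= -ed to_frac_frac.
suff <- : psi d = b * (u * v) by exact: subring_incl_mem.
apply: breg; rewrite -{1}ex -rmorphM -exd rmorphM /= ey ez.
by rewrite mulrACA -mulrA.
Qed.

(** The iterated blow-ups of [D] all have this form. *)
Definition blowup (b : B) : set B := [set u | b * u \in D].

Lemma blowup_sub b u : b \in D -> u \in D -> blowup b u.
Proof. by move=> Db Du; rewrite /blowup /= rpredM. Qed.

Lemma blowup_iota b a : b \in D -> blowup b (iota a).
Proof. by move=> Db; exact: blowup_sub. Qed.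

Lemma blowup_subring b : GRing.lreg b -> b \in D -> is_subring (blowup b).
Proof.
move=> breg Db; rewrite /blowup; split; first by rewrite /= mulr1.
by move=> x y /= Dx Dy; split; [rewrite mulrBr rpredB | exact: arf_quotient].
Qed.

Lemma blowup_module_submodule b L : b \in D -> is_module (blowup b) L -> is_submodule L.
Proof.
move=> Db [L0 LD LE]; split=> // a x Lx; rewrite closure_scaleE.
by apply: LE => //; exact: blowup_iota.
Qed.

Lemma maximal_blowup_module b : b \in D -> forall G : set B -> Prop,
  (forall L, G L -> is_module (blowup b) L) -> (exists L, G L) ->
  exists L, G L /\ forall L', G L' -> L `<=` L' -> L' = L.
Proof.
move=> Db G Gm; apply: (maximal_submodule_in (closure_submodules_fin_gen noethA fgB)).
by move=> L GL; apply: (blowup_module_submodule Db); exact: Gm.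
Qed.

(** Multiply the monic equation of [w] by the power of [a] that leaves one
    factor [w] in the leading term. *)
Lemma blowup_inverse b (a w : B) : GRing.lreg b -> b \in D -> blowup b a -> a * w = 1 ->
  blowup b w.
Proof.
move=> breg Db Ea aw; have subE := blowup_subring breg Db.
have [n [c ec]] := closure_integral w.
case: n ec => [|n ec].
  by rewrite big_ord0 addr0 expr0 => /eqP; rewrite oner_eq0.
have Eexp i : blowup b (a ^+ i).
  elim: i => [|i IH]; first by rewrite expr0; have [] := subE.
  by rewrite exprS; exact: (subringM subE).
have -> : w = - \sum_(i < n.+1) iota (c i) * a ^+ (n - i).
  apply/eqP; rewrite -addr_eq0; apply/eqP.
  transitivity (a ^+ n * (w ^+ n.+1 + \sum_(i < n.+1) iota (c i) * w ^+ i)); last first.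
    by rewrite ec mulr0.
  rewrite mulrDr exprS mulrCA -exprMn aw expr1n mulr1 mulr_sumr; congr (_ + _).
  apply: eq_bigr => i _; rewrite mulrCA; congr (_ * _).
  have -> : a ^+ n = a ^+ (n - i) * a ^+ i by rewrite -exprD subnK // -ltnS.
  by rewrite -mulrA -exprMn aw expr1n mulr1.
apply: (subringN subE); elim/big_ind: _ => [|x y Ex Ey|i _].
- exact: (subring0 subE).
- exact: (subringD subE).
- by apply: (subringM subE) => //; exact: blowup_iota.
Qed.

Section RadicalIdeal.

Variables (b : B) (N : set B).
Hypotheses (breg : GRing.lreg b) (Db : b \in D).
Local Notation E := (blowup b).
Hypotheses (NE : N `<=` E) (modN : is_module E N).
Hypothesis radN : forall u n, E u -> N (u ^+ n) -> N u.

(** The first Arf condition speaks of ideals of [D], so an ideal [N] of the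
    blow-up is transported to the ideal [b N] of [D]. *)
Definition scaled_ideal : set S := [set d | exists2 u, N u & psi d = b * u].
Local Notation J := scaled_ideal.

Lemma scaled_idealP u : N u -> exists2 d, J d & psi d = b * u.
Proof. by move=> Nu; have [d ed] := subring_inclP (NE Nu); exists d => //; exists u. Qed.

Lemma scaled_power_ideal i : is_ideal [set z | exists2 u, N u & psi z = b ^+ i * u].
Proof.
have [N0 ND NEm] := modN; split.
- by exists 0; rewrite ?rmorph0 ?mulr0.
- move=> x y [u Nu eu] [v Nv ev]; exists (u + v); first exact: ND.
  by rewrite rmorphD /= eu ev mulrDr.
move=> d x [u Nu eu]; exists (psi d * u); last by rewrite rmorphM /= eu mulrCA.
by apply: NEm => //; apply: blowup_sub => //; exact: subring_incl_mem.
Qed.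

Lemma scaled_ideal_ideal : is_ideal J.
Proof. by have := scaled_power_ideal 1; rewrite expr1. Qed.

Lemma scaled_ideal_exp i z : ideal_exp J i.+1 z -> exists2 u, N u & psi z = b ^+ i.+1 * u.
Proof.
have [N0 ND NEm] := modN.
elim: i z => [|i IH] z; move: z; apply: smallest_sub; try exact: scaled_power_ideal;
  move=> _ [x [u Nu eu] [y Jy <-]].
  exists (psi y * u); last by rewrite rmorphM /= eu expr1 mulrAC -mulrA mulrC -mulrA mulrC -mulrA.
  by apply: NEm => //; apply: blowup_sub => //; exact: subring_incl_mem.
have [v Nv ev] := IH y Jy; exists (u * v); first by apply: NEm => //; exact: NE.
by rewrite rmorphM /= eu ev mulrACA -exprS.
Qed.

(** An element [d] of [D] that is integral over [b N] is a multiple [b w] with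
    [w] integral, so [w] is in the blow-up, and the equation of [w] has its
    coefficients in [N]; as [N] is radical, [w] is in [N]. *)
Lemma scaled_ideal_closed : integrally_closed_ideal J.
Proof.
have [N0 ND NEm] := modN.
split; first exact: scaled_ideal_ideal.
move=> d [n [c [n0 Jc e]]].
have [r br] := closure_lreg_unit breg.
have /choice[u uP] i : exists u, (1 <= i <= n)%N -> N u /\ psi (c i) = b ^+ i * u.
  have [/andP[i1 il]|] := boolP (1 <= i <= n)%N; last by exists 0.
  have := @scaled_ideal_exp i.-1 (c i); rewrite prednK // => h.
  by have [|u Nu eu] := h; [apply: Jc; rewrite i1 | exists u].
have cancel (q : total_frac A) : closure_frac b ^+ n * q = 0 -> q = 0.
  by move=> e0; rewrite -[LHS]mul1r -(expr1n _ n) -br exprMn mulrAC e0 mul0r.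
(* the equation of d, divided by b ^+ n and with its terms in increasing degree *)
have eB : psi d ^+ n + \sum_(i < n) u (n - i)%N * (b ^+ (n - i) * psi d ^+ i) = 0.
  have eS : d ^+ n + \sum_(i < n) c (n - i)%N * d ^+ i = 0.
    rewrite -[RHS]e big_add1 big_mkord [in RHS](reindex_inj rev_ord_inj); congr (_ + _).
    by apply: eq_bigr => i _ /=; rewrite subnSK ?ltn_ord // subKn // ltnW.
  transitivity (psi (0 : S)); last by rewrite rmorph0.
  rewrite -eS rmorphD rmorphXn rmorph_sum; congr (_ + _); apply: eq_bigr => i _.
  have [|_ ec] := uP (n - i)%N; first by rewrite subn_gt0 ltn_ord leq_subr.
  by rewrite rmorphM rmorphXn /= ec mulrA [u _ * _]mulrC.
have [w ew] : exists w : B, closure_frac w = r * closure_frac (psi d).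
  apply: (@integral_over_closure A _ n (fun i => u (n - i)%N)); apply: cancel.
  rewrite -(homogenize _ _ _ (fun i => closure_frac (u (n - i)%N))) mulrA br mul1r.
  transitivity (closure_frac (0 : B)); last by rewrite rmorph0.
  rewrite -eB rmorphD rmorphXn rmorph_sum; congr (_ + _).
  by apply: eq_bigr => i _; rewrite !rmorphM !rmorphXn.
have ebw : psi d = b * w.
  by apply: closure_frac_inj; rewrite rmorphM /= ew mulrA br mul1r.
exists w => //.
have Ew : E w by rewrite /blowup /= -ebw; exact: subring_incl_mem.
apply: (radN (n := n)) => //.
have wn : w ^+ n = - \sum_(i < n) u (n - i)%N * w ^+ i.
  apply/eqP; rewrite -addr_eq0; apply/eqP; apply: (lregX (n := n) breg).
  by rewrite mulr0 -(homogenize b w n (fun i => u (n - i)%N)) -ebw.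
have subE := blowup_subring breg Db.
rewrite wn; apply: (moduleN subE) => //; elim/big_ind: _ => // i _.
rewrite mulrC; apply: NEm; last by have [] := uP (n - i)%N; rewrite ?subn_gt0 ?ltn_ord ?leq_subr.
elim: (i : nat) => [|j IH]; first by rewrite expr0; have [] := subE.
by rewrite exprS; exact: (subringM subE).
Qed.

(** From [J ^ (m + 1) = al J ^ m] it follows that [z / al] maps [J ^ m] into
    itself for every [z] in [J]; so [z / al] is almost integral. *)
Lemma radical_ideal_generator : (exists2 nu, N nu & GRing.lreg nu) ->
  exists a, [/\ N a, GRing.lreg a & forall r, N r -> principal a r].
Proof.
move=> [nu Nnu nureg].
have [d0 Jd0 ed0] := scaled_idealP Nnu.
have d0reg : GRing.lreg d0.
  by apply: (closure_lreg_intermediate psi_inj); rewrite /= ed0; exact: lregM.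
have [_ [_ _ _ red _]] := arfD.
have [|m [al [Jal ered]]] := red J scaled_ideal_closed.
  by exists d0; split=> //; apply/asboolP.
have step z x : J z -> ideal_exp J m x -> exists2 y, ideal_exp J m y & z * x = al * y.
  move=> Jz Jx; have : ideal_exp J m.+1 (z * x).
    by apply: sub_gen_smallest; exists z => //; exists x.
  by rewrite ered => -[y Jy <-]; exists y.
have [a Na ea] := Jal.
have Jd0m i : ideal_exp J i (d0 ^+ i).
  elim: i => // i IH; rewrite exprS; apply: sub_gen_smallest.
  by exists d0 => //; exists (d0 ^+ i).
have alreg : GRing.lreg (psi al).
  have [y _ ey] := step _ _ Jd0 (Jd0m m).
  apply: (@lreg_factor _ _ (psi y)); rewrite -rmorphM -ey.
  by apply: (lreg_closure psi_inj psi_phi); rewrite -exprS; exact: lregX.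
have areg : GRing.lreg a by apply: (@lreg_factor _ _ b); rewrite mulrC -ea.
exists a; split=> // r Nr.
have [z Jz ez] := scaled_idealP Nr.
have [s als] := closure_lreg_unit alreg.
have d0m : GRing.lreg (psi (d0 ^+ m)).
  by apply: (lreg_closure psi_inj psi_phi); exact: lregX.
have [k|y ey] := almost_integral noethA fgB (q := closure_frac (psi z) * s) d0m.
  suff [x _ ex] : exists2 x, ideal_exp J m x & closure_frac (psi x) =
      closure_frac (psi (d0 ^+ m)) * (closure_frac (psi z) * s) ^+ k by exists (psi x).
  elim: k => [|k [x Jx ex]]; first by exists (d0 ^+ m); rewrite ?expr0 ?mulr1.
  have [y Jy ey] := step z x Jz Jx; exists y => //.
  have e2 : psi z * psi x = psi al * psi y by have := congr1 psi ey; rewrite 2!rmorphM.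
  rewrite exprS mulrCA -ex mulrAC -(rmorphM (@closure_frac A)) e2 rmorphM /=.
  by rewrite mulrAC als mul1r.
exists y => //; apply: breg; rewrite -ez mulrA -ea; apply: closure_frac_inj.
by rewrite rmorphM /= ey mulrCA als mulr1.
Qed.

End RadicalIdeal.

(** Noetherian induction on the blow-up [E]. Let [x] be strictly closed over [E]
    and not in [E], let [N] be a maximal ideal of [E] containing the
    denominators of [x], and let [a] be the element of [N] that generates the
    extension of [N]. Modulo [E], [x] is a multiple [a y]; and [y] is strictly
    closed over the next blow-up [{u | a u \in E}], so [y] is in it by
    induction, and [a y] is in [E]. The next blow-up is strictly larger than
    [E]: otherwise [N = a E], and a regular denominator of [x] could be divided
    by [a] indefinitely. *)
Lemma blowup_strictly_closed b x : GRing.lreg b -> b \in D ->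
  strictly_closed_over (blowup b) x -> blowup b x.
Proof.
have noethB := closure_submodules_fin_gen noethA fgB.
move=> breg Db.
have blowup_submodule c : GRing.lreg c -> c \in D -> is_submodule (blowup c).
  move=> creg Dc; have subE := blowup_subring creg Dc.
  split; first exact: (subring0 subE).
    by move=> u v; exact: (subringD subE).
  by move=> a u Eu; rewrite closure_scaleE; apply: (subringM subE) => //; exact: blowup_iota.
suff claim : forall M, is_submodule M -> forall c y, GRing.lreg c -> c \in D -> M = blowup c ->
    strictly_closed_over (blowup c) y -> blowup c y.
  by apply: (claim (blowup b)) => //; exact: blowup_submodule.
move=> {b x breg Db}; apply: (submodule_induction noethB) => M _ IH b x breg Db eM xstrict.
apply: contrapT => nEx.
set E := blowup b in eM xstrict nEx *.
have subE : is_subring E by exact: blowup_subring.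
have E1 : E 1 by case: subE.
pose I : set B := [set d | E d /\ E (d * x)].
pose G N := [/\ is_module E N, N `<=` E, I `<=` N & ~ N 1].
have [N []||N [[modN NE IN nN1] maxN]] := maximal_blowup_module Db (G := G) => //.
  exists I; split=> //; last by move=> [_]; rewrite mul1r.
    split.
    - by split; rewrite ?mul0r; exact: (subring0 subE).
    - move=> u v [Eu Eux] [Ev Evx]; rewrite /I /= mulrDl.
      by split; exact: (subringD subE).
    - move=> e u Ee [Eu Eux]; rewrite /I /= -mulrA.
      by split; exact: (subringM subE).
  by move=> d [].
have [N0 ND NEm] := modN.
have unitN d : E d -> ~ N d -> exists2 e, E e & N (1 - e * d).
  move=> Ed nNd; have : module_adjoin E N d 1.
    apply: contrapT => n1; apply: nNd; rewrite -(maxN (module_adjoin E N d)).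
    - exact: (mem_module_adjoin subE).
    - split=> //; first exact: (module_adjoin_module subE).
        move=> _ [l [r [Nl Er ->]]]; apply: (subringD subE); first exact: NE.
        exact: (subringM subE).
      by apply: subset_trans IN _; exact: (sub_module_adjoin subE).
    - exact: (sub_module_adjoin subE).
  by move=> [l [r [Nl Er ->]]]; exists r => //; rewrite addrK.
have Eexp u i : E u -> E (u ^+ i).
  move=> Eu; elim: i => [|i IHi]; first by rewrite expr0.
  by rewrite exprS; exact: (subringM subE).
have radN u n : E u -> N (u ^+ n) -> N u.
  move=> Eu Nun; apply: contrapT => nNu; have [e Ee Ne] := unitN u Eu nNu.
  apply: nN1; rewrite -[1](subrK ((e * u) ^+ n)); apply: ND; last first.
    by rewrite exprMn; apply: NEm => //; exact: Eexp.
  rewrite -[X in X - _](expr1n _ n) subrXX mulrC; apply: NEm => //.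
  elim/big_ind: _ => [|y z Ey Ez|i _]; first exact: (subring0 subE).
    exact: (subringD subE).
  by rewrite expr1n mul1r; apply: Eexp; exact: (subringM subE).
have [s [t [sreg est]]] := closureP x.
have Is : I (iota s).
  by split; [exact: blowup_iota | rewrite est; exact: blowup_iota].
have [|a [Na areg aN]] := radical_ideal_generator breg Db NE modN radN.
  by exists (iota s); [exact: IN | exact: iota_lreg].
have Ea : E a by exact: NE.
have nunit : ~ principal a 1.
  move=> [w _ aw]; apply: nN1; rewrite -aw mulrC; apply: NEm => //.
  exact: (blowup_inverse breg Db Ea aw).
have residue d : E d -> ~ principal a d -> exists2 e, E e & principal a (1 - e * d).
  move=> Ed nad; have [|e Ee Ne] := unitN d Ed; first by move=> /aN.
  by exists e => //; exact: aN.
have creg : GRing.lreg (b * a) by exact: lregM.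
have Dc : b * a \in D by exact: Ea.
have blowupE u : blowup (b * a) u = E (a * u) :> Prop.
  by rewrite /E /blowup /= mulrA.
have EE' : E `<=` blowup (b * a).
  by move=> u Eu; rewrite blowupE; exact: (subringM subE).
have [same|bigger] := pselect (blowup (b * a) = E).
  (* then a can be cancelled from regular elements of the conductor forever *)
  have Ediv u : E (a * u) -> E u by rewrite -blowupE same.
  have scale_submodule be : is_submodule [set be * e | e in E].
    split; first by exists 0; rewrite ?mulr0 //; exact: (subring0 subE).
      move=> _ _ [u Eu <-] [v Ev <-]; exists (u + v); last by rewrite mulrDr.
      exact: (subringD subE).
    move=> k _ [u Eu <-]; exists (iota k * u); last by rewrite closure_scaleE mulrCA.
    by apply: (subringM subE) => //; exact: blowup_iota.
  suff never : forall M, is_submodule M -> forall be, M = [set be * e | e in E] -> I be ->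
      GRing.lreg be -> False.
    exact: (never _ (scale_submodule (iota s)) (iota s)) (iota_lreg sreg).
  apply: (submodule_induction noethB) => {M eM} M _ {}IH be eM Ibe bereg.
  have [be1 _ e1] := aN be (IN be Ibe); have [Ebe Ebex] := Ibe.
  have be1reg : GRing.lreg be1 by apply: (@lreg_factor _ _ a); rewrite mulrC e1.
  apply: (IH [set be1 * e | e in E] _ _ _ be1) => //.
  - rewrite eM => _ [e Ee <-]; exists (a * e); first exact: (subringM subE).
    by rewrite mulrA [be1 * a]mulrC e1.
  - rewrite eM => e; have : [set be1 * e | e in E] be1 by exists 1; rewrite ?mulr1.
    rewrite e => -[w Ew ew]; apply: nunit; exists w => //; apply: be1reg.
    by rewrite mulr1 mulrA [be1 * a]mulrC e1.
  by split; apply: Ediv; rewrite ?mulrA e1.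
have [v [y [Ev exy]]] := strictly_closed_residue subE (maximal_blowup_module Db) nunit residue xstrict.
have aystrict : strictly_closed_over E (a * y).
  move=> T F Fadd Fbal; have [FD FDr] := Fadd.
  have := xstrict T F Fadd Fbal; rewrite exy FD FDr.
  have -> : F v 1 = F 1 v by rewrite -[v in LHS]mulr1 (Fbal v Ev) mulr1.
  exact: addrI.
apply: nEx; rewrite exy; apply: (subringD subE) => //; rewrite -blowupE.
apply: (IH (blowup (b * a))) => //.
- exact: blowup_submodule.
- by rewrite eM.
- by rewrite eM.
move=> T F Fadd Fbal.
apply: (strictly_closed_divide subE (maximal_blowup_module Db) Ea areg residue aystrict Fadd).
by move=> c Eac; apply: Fbal; rewrite blowupE.
Qed.

Lemma strict_closure_sub_arf : {subset strict_closure A <= D}.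
Proof.
move=> x /strict_closureE ex.
suff : blowup 1 x by rewrite /blowup /= mul1r.
apply: blowup_strictly_closed; [exact: lreg1 | exact: rpred1 | move=> T F [FD FDr] Fbal].
have Fiota a : central F (iota a) by apply: Fbal; apply: blowup_iota; exact: rpred1.
have [a u v|G GE] := @tensor_lift A B B T F FD FDr.
  by rewrite !closure_scaleE Fiota.
by rewrite -!GE ex.
Qed.

End ArfIntermediate.

Theorem theorem1p6 (A : comNzRingType) :
  noetherian A -> semilocal A -> locally_cm_dim1 A ->
  finitely_generated (integral_closure A) ->
  is_arf_closure (strict_closure A).
Proof.
move=> noethA semiA cmA fgB; split.
  by split; [exact: iota_strict | exact: strict_closure_arf].
by move=> D arfD; exact: strict_closure_sub_arf.
Qed.
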